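(* Let $\mathcal V$ be a Borel set of closed subgroups of $S_\infty$ that is closed under conjugation in $S_\infty$. Suppose that every group in $\mathcal V$ has only countably many open subgroups. Then the relation of topological group isomorphism on $\mathcal V$ is classifiable by countable structures. In particular, this is the case for the class of oligomorphic closed subgroups of $S_\infty$ and for the class of Roelcke precompact closed subgroups of $S_\infty$.
   Context: $S_\infty$ is the Polish group of all permutations of $\omega$ with the topology of pointwise convergence. $\mathcal F(S_\infty)$ is the set of closed subsets of $S_\infty$ with the Effros Borel structure, i.e. the $\sigma$-algebra generated by the sets $\{D\in\mathcal F(S_\infty)\colon D\cap U\neq\emptyset\}$ for $U\subseteq S_\infty$ open. ''Borel set of closed subgroups'' means Borel as a subset of $\mathcal F(S_\infty)$. A closed subgroup $G$ of $S_\infty$ is oligomorphic if for each $n$ the natural action of $G$ on $\omega^n$ has only finitely many orbits. A topological group $G$ is Roelcke precompact if for each neighbourhood $U$ of $1$ there is a finite set $F\subseteq G$ such that $UFU=G$. An equivalence relation $E$ on a standard Borel space $X$ is classifiable by countable structures if in a Borel way one can assign to $x\in X$ a countable structure $M_x$ in a fixed countable language (a point in the Polish space of structures with domain $\omega$) so that $xEx'\Leftrightarrow M_x\cong M_{x'}$ for all $x,x'\in X$. *)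

(* Defs.v *)
From HB Require Import structures.
From mathcomp Require Import all_boot.
From mathcomp Require Import all_classical.
From mathcomp Require Import topology function_spaces measure.

Set Implicit Arguments.
Unset Strict Implicit.
Unset Printing Implicit Defensive.

Local Open Scope classical_set_scope.
Local Open Scope group_scope.

(* As a [set_type], it carries the subspace topology inherited from
   [{ptws nat -> nat}], i.e. the topology of pointwise convergence. *)
Definition Sinf : Type := [set f : {ptws nat -> nat} | bijective f].

HB.instance Definition _ := Topological.on Sinf.

Definition Sinf_fun (s : Sinf) : nat -> nat := \val s.
Coercion Sinf_fun : Sinf >-> Funclass.

Definition Sinf_of (f : nat -> nat) (bf : bijective f) : Sinf :=
  exist _ (f : {ptws nat -> nat}) (mem_set bf).

Lemma Sinf_bij (s : Sinf) : bijective s.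
Proof. by case: s => f fP; exact: (set_mem fP). Qed.

Lemma Sinf_ext (s t : Sinf) : s =1 t -> s = t.
Proof. by move=> st; apply/val_inj/funext. Qed.

Lemma Sinf_inv_subproof (s : Sinf) : {g : nat -> nat | cancel s g /\ cancel g s}.
Proof. by apply: cid; have [g sK gK] := Sinf_bij s; exists g. Qed.

Definition Sinf_inv_fun (s : Sinf) : nat -> nat := sval (Sinf_inv_subproof s).

Lemma Sinf_funK (s : Sinf) : cancel s (Sinf_inv_fun s).
Proof. by rewrite /Sinf_inv_fun; case: Sinf_inv_subproof => g []. Qed.

Lemma Sinf_invK (s : Sinf) : cancel (Sinf_inv_fun s) s.
Proof. by rewrite /Sinf_inv_fun; case: Sinf_inv_subproof => g []. Qed.

Lemma Sinf_inv_bij (s : Sinf) : bijective (Sinf_inv_fun s).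
Proof. exact: Bijective (Sinf_invK s) (Sinf_funK s). Qed.

Lemma Sinf_one_bij : bijective (id : nat -> nat).
Proof. by exists id. Qed.

Definition Sinf_one : Sinf := Sinf_of Sinf_one_bij.
Definition Sinf_mul (s t : Sinf) : Sinf :=
  Sinf_of (bij_comp (Sinf_bij s) (Sinf_bij t)).
Definition Sinf_inv (s : Sinf) : Sinf := Sinf_of (Sinf_inv_bij s).

Lemma Sinf_mulA : associative Sinf_mul.
Proof. by move=> s t u; exact: Sinf_ext. Qed.

Lemma Sinf_mul1s : left_id Sinf_one Sinf_mul.
Proof. by move=> s; exact: Sinf_ext. Qed.

Lemma Sinf_muls1 : right_id Sinf_one Sinf_mul.
Proof. by move=> s; exact: Sinf_ext. Qed.

Lemma Sinf_mulVs : left_inverse Sinf_one Sinf_inv Sinf_mul.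
Proof. by move=> s; apply: Sinf_ext => n; exact: Sinf_funK. Qed.

Lemma Sinf_mulsV : right_inverse Sinf_one Sinf_inv Sinf_mul.
Proof. by move=> s; apply: Sinf_ext => n; exact: Sinf_invK. Qed.

(* The product is composition of functions: [(s * t) n = s (t n)]. *)
HB.instance Definition _ :=
  isGroup.Build Sinf Sinf_mulA Sinf_mul1s Sinf_muls1 Sinf_mulVs Sinf_mulsV.

Definition closed_subset : Type := [set D : set Sinf | closed D].

Definition closed_subset_set (D : closed_subset) : set Sinf := \val D.
Coercion closed_subset_set : closed_subset >-> set.

HB.instance Definition _ := Choice.on closed_subset.

Definition closed_subset_full : closed_subset :=
  exist _ [set: Sinf] (mem_set closedT).

HB.instance Definition _ := isPointed.Build closed_subset closed_subset_full.

Definition effros_generators : set (set closed_subset) :=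
  [set [set D : closed_subset | (D : set Sinf) `&` U !=set0] |
    U in [set U : set Sinf | open U]].

Notation effros := (g_sigma_algebraType effros_generators).

Definition subgroup (G : set Sinf) : Prop :=
  [/\ G 1, forall x y, G x -> G y -> G (x * y) & forall x, G x -> G x^-1].

Definition open_subgroups (G : set Sinf) : set (set Sinf) :=
  [set U | [/\ subgroup U, U `<=` G & exists2 O, open O & U = G `&` O]].

Definition conjugation_closed (V : set closed_subset) : Prop :=
  forall (G H : closed_subset) (g : Sinf), V G ->
    (H : set Sinf) = [set g * x * g^-1 | x in (G : set Sinf)] -> V H.

Definition tuple_orbit (G : set Sinf) n (a : n.-tuple nat) :
    set (n.-tuple nat) :=
  [set map_tuple (g : Sinf) a | g in G].

Definition oligomorphic (G : set Sinf) : Prop :=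
  forall n, finite_set (range (@tuple_orbit G n)).

(* [U] ranges over the neighbourhoods of [1] in the subspace [G]. *)
Definition roelcke_precompact (G : set Sinf) : Prop :=
  forall U : set Sinf, U `<=` G -> within G (nbhs (1 : Sinf)) U ->
    exists F : set Sinf, [/\ finite_set F, F `<=` G &
      [set x | exists u f v, [/\ U u, F f, U v & x = u * f * v]] = G].

Definition topologically_isomorphic (G H : set Sinf) : Prop :=
  exists phi psi : Sinf -> Sinf,
    [/\ set_fun G H phi /\ set_fun H G psi,
        {in G, cancel phi psi} /\ {in H, cancel psi phi},
        {in G &, {morph phi : x y / x * y}},
        {within G, continuous phi} & {within H, continuous psi}].

Definition oligomorphic_subgroups : set closed_subset :=
  [set G | subgroup G /\ oligomorphic G].

Definition roelcke_precompact_subgroups : set closed_subset :=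
  [set G | subgroup G /\ roelcke_precompact G].

(* A countable first-order language; constants are 0-ary function symbols. *)
Record language := Language {
  rel_symbol : countType;
  rel_arity : rel_symbol -> nat;
  fun_symbol : countType;
  fun_arity : fun_symbol -> nat }.

(* The [L]-structures with domain [nat], with the product topology of
   the spaces 2^(nat^k) and nat^(nat^k). *)
Definition structure_space (L : language) : Type :=
  (prod_topology (fun R : rel_symbol L => {ptws (rel_arity R).-tuple nat -> bool})
   * prod_topology (fun f : fun_symbol L => {ptws (fun_arity f).-tuple nat -> nat}))%type.

HB.instance Definition _ L := Topological.on (structure_space L).

HB.instance Definition _ L :=
  isPointed.Build (structure_space L) (fun _ _ => false, fun _ _ => 0%N).

Notation borel_structure L :=
  (g_sigma_algebraType [set U : set (structure_space L) | open U]).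

Definition structure_isomorphic L (M N : structure_space L) : Prop :=
  exists p : nat -> nat, [/\ bijective p,
    forall (R : rel_symbol L) (a : (rel_arity R).-tuple nat),
      N.1 R (map_tuple p a) = M.1 R a &
    forall (f : fun_symbol L) (a : (fun_arity f).-tuple nat),
      N.2 f (map_tuple p a) = p (M.2 f a)].

(* [E] is considered on the Borel subset [D] of [X]; the values of [M] outside
   [D] are irrelevant. The measurability of [D] is stated explicitly, since
   otherwise [measurable_fun D M] would hold vacuously. *)
Definition classifiable_by_countable_structures d (X : measurableType d)
    (D : set X) (E : X -> X -> Prop) : Prop :=
  measurable D /\
  exists (L : language) (M : X -> borel_structure L),
    measurable_fun D M /\
    forall x y, D x -> D y -> (E x y <-> structure_isomorphic (M x) (M y)).

(* Main.v *)
Require Import Defs.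
From mathcomp Require Import all_boot all_classical topology function_spaces measure.

(**
The countable structure attached to a group [G] is its coarse group: the open cosets of [G]
with the ternary relation [A B `<=` C].  Two points have to be settled.

The coarse group determines [G].  A bijection between the open cosets of [G] and those of [H]
that respects the relation respects inclusions and subgroups.  It sends the filter of open
cosets containing a given [g] to a filter on [H] that contains, for each [n], a coset whose elements
agree below [n], so this filter converges pointwise to a function.  These limits depend
multiplicatively on [g], hence they are permutations; they lie in [H] since [H] is closed
([reconstruct_morphism], [reconstruct_isomorphism]).  Conversely a topological isomorphism
permutes open cosets.  The structures live on [nat], so open cosets are represented by names;
giving each coset infinitely many names turns an isomorphism of groups into a bijection of names
([isomorphism_renaming]).

The coarse group is a Borel function of [G].  An open coset is a union of left cosets of the
stabilizer of [0, ..., n-1] for some [n], so it is described by the set of images of the tuple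
[(0, ..., n-1)] under its elements, and the sets arising in this way form a closed subset of
Cantor space, depending on [G] in a Borel way ([branches_coset_tree]).  When [G] has countably
many open subgroups this closed set is countable.  What is needed is the Lusin-Novikov theorem
for countable closed sections, [measurable_enumeration].  A countable closed set of branches
vanishes under iterated Cantor-Bendixson derivatives, and each of its points is isolated in some
derivative and so is definable from a finite sequence and the index of that derivative.  The
indices have to be countable in number, uniformly over the Borel set of groups, which is the
boundedness theorem.  Here the derivatives are indexed directly by the nodes of the tree of
attempts to build a code of a group in the given Borel set together with a perfect subtree of its
tree of cosets.  This tree has countably many nodes, and it is well founded because Borel sets are
analytic and no such perfect subtree exists ([extends_wf], [derivative_dies]).

For closed subgroups, being Roelcke precompact amounts to having finitely many double cosets of
each pointwise stabilizer, a Borel condition that oligomorphic groups satisfy.  An open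
subgroup is a union of such double cosets, so there are only countably many open subgroups.
*)

Set Implicit Arguments.
Unset Strict Implicit.
Unset Printing Implicit Defensive.

Local Open Scope classical_set_scope.

(** * Measurable predicates *)

Section MeasurablePredicates.
Context d (X : measurableType d).
Implicit Types (I : countType) (A B C : X -> Prop).

(** Measurability in terms of predicates follows the shape of a formula: every quantifier over
    a countable type is a countable union or intersection, and quantifier-free parts that do not
    mention the point of the space are constant. *)
Definition measurable_pred A := measurable [set x | A x].

Lemma mpred_ext A B : (forall x, A x <-> B x) -> measurable_pred A -> measurable_pred B.
Proof.
by move=> AB; rewrite /measurable_pred (_ : mkset A = mkset B)//; apply/seteqP; split=> x /AB.
Qed.

Lemma mpred_cst (P : Prop) : measurable_pred (fun=> P).
Proof.
have [p|np] := pselect P.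
  by apply: mpred_ext (@measurableT _ X) => x; split.
by apply: mpred_ext (@measurable0 _ X) => x; split.
Qed.

Lemma mpred_and A B : measurable_pred A -> measurable_pred B ->
  measurable_pred (fun x => A x /\ B x).
Proof. exact: measurableI. Qed.

Lemma mpred_or A B : measurable_pred A -> measurable_pred B ->
  measurable_pred (fun x => A x \/ B x).
Proof. exact: measurableU. Qed.

Lemma mpred_not A : measurable_pred A -> measurable_pred (fun x => ~ A x).
Proof. exact: measurableC. Qed.

Lemma mpred_imply A B : measurable_pred A -> measurable_pred B ->
  measurable_pred (fun x => A x -> B x).
Proof.
move=> mA mB; apply: mpred_ext (mpred_or (mpred_not mA) mB) => x.
by split=> [[]//|AB]; have [/AB|] := pselect (A x); [right|left].
Qed.

Lemma mpred_iff A B : measurable_pred A -> measurable_pred B ->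
  measurable_pred (fun x => A x <-> B x).
Proof. by move=> mA mB; apply: mpred_and; exact: mpred_imply. Qed.

Lemma mpred_exists I (A : I -> X -> Prop) :
  (forall i, measurable_pred (A i)) -> measurable_pred (fun x => exists i, A i x).
Proof.
move=> mA.
have := countable_bigcupT_measurable (countableP [set: I]) mA.
by apply: mpred_ext => x; split=> [[i _]|[i]]; exists i.
Qed.

Lemma mpred_forall I (A : I -> X -> Prop) :
  (forall i, measurable_pred (A i)) -> measurable_pred (fun x => forall i, A i x).
Proof.
move=> mA; apply: mpred_ext (mpred_not (mpred_exists (fun i => mpred_not (mA i)))) => x.
by split=> [/forallNP H i|H [i]]; [exact: contrapT|apply].
Qed.

End MeasurablePredicates.

(** * Analytic sets of sequences *)

Section BianalyticSets.
Variable E : Type.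
Implicit Types (w v : nat -> E) (y : nat -> nat) (B : set (nat -> E)).

Definition agree T n (u v : nat -> T) := forall i, i < n -> u i = v i.

(** Closedness of [F] in the product of the discrete sequence spaces: a point of the closure is
    one all of whose finite approximations extend to points of [F]. *)
Definition closed_relation (F : (nat -> E) -> (nat -> nat) -> Prop) :=
  forall w y,
    (forall n, exists v x, [/\ F v x, agree n v w & agree n x y]) -> F w y.

Definition analytic B := exists F,
  closed_relation F /\ forall w, B w <-> exists y, F w y.

(** The class of bianalytic sets is a sigma-algebra, so it contains the Borel sets.  This is
    the easy half of Suslin's theorem. *)
Definition bianalytic B := analytic B /\ analytic (~` B).

Lemma bianalyticC B : bianalytic B -> bianalytic (~` B).
Proof. by case=> aB aCB; split; rewrite ?setCK. Qed.

(** The first entry of the witness names a set of the union, the others witness membership. *)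
Lemma analytic_bigcup (B : nat -> set (nat -> E)) :
  (forall k, analytic (B k)) -> analytic (\bigcup_k B k).
Proof.
move=> /choice[F /all_and2 [Fc BF]].
exists (fun w y => F (y 0) w (fun i => y i.+1)); split.
  move=> w y wy; apply: Fc => n.
  have [v [x [Fvx vw xy]]] := wy n.+1.
  exists v, (fun i => x i.+1); rewrite -(xy 0)//; split => // i ni.
    by apply: vw; exact: leqW.
  exact: xy.
move=> w; split=> [[k _ /BF[y Fy]]|[y Fy]]; last first.
  by exists (y 0) => //; apply/BF; exists (fun i => y i.+1).
by exists (fun i => if i is j.+1 then y j else k).
Qed.

(** A single sequence codes witnesses for all the sets at once, along a pairing of the indices.
    An initial segment of each witness is contained in an initial segment of the code, which
    keeps the relation closed. *)
Lemma analytic_bigcap (B : nat -> set (nat -> E)) :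
  (forall k, analytic (B k)) -> analytic (\bigcap_k B k).
Proof.
move=> /choice[F /all_and2 [Fc BF]].
exists (fun w y => forall k, F k w (fun i => y (pickle (k, i)))); split.
  move=> w y wy k; apply: Fc => n.
  pose N := maxn n (\max_(i < n) (pickle (k, (i : nat))).+1).
  have [v [x [Fvx vw xy]]] := wy N.
  exists v, (fun i => x (pickle (k, i))); split => // i ni.
    by apply: vw; rewrite leq_max ni.
  apply: xy; rewrite leq_max; apply/orP; right.
  exact: (@leq_bigmax _ (fun j : 'I_n => (pickle (k, (j : nat))).+1) (Ordinal ni)).
move=> w; split=> [Bw|[y Fy] k _]; last first.
  by apply/BF; exists (fun i => y (pickle (k, i))).
have /choice[y Fy] k : exists y, F k w y by apply/BF; exact: Bw.
exists (fun i => if unpickle i is Some (k, j) then y k j else 0) => k.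
by under eq_fun do rewrite pickleK.
Qed.

(** Such a set is clopen, hence it is itself a closed relation that ignores the witness. *)
Lemma bianalytic_locally_constant B :
  (forall w, exists n, forall v, agree n v w -> B v <-> B w) -> bianalytic B.
Proof.
move=> lB.
suff aB C : (forall w, exists n, forall v, agree n v w -> C v <-> C w) ->
    analytic C.
  split; apply: aB => // w; have [n nw] := lB w; exists n => v /nw vw.
  by rewrite /setC /= vw.
move=> lC; exists (fun w _ => C w); split; last first.
  by move=> w; split=> [|[]//]; exists (fun=> 0).
by move=> w y wy; have [n nw] := lC w; have [v [_ [Cv /nw vw _]]] := wy n; apply/vw.
Qed.

Lemma bianalytic0 : bianalytic set0.
Proof. by apply: bianalytic_locally_constant; exists 0. Qed.

Lemma bianalytic_bigcup (I : countType) (P : set I) (B : I -> set (nat -> E)) :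
  (forall k, P k -> bianalytic (B k)) -> bianalytic (\bigcup_(k in P) B k).
Proof.
move=> bB.
pose C n := if unpickle n is Some k then if `[< P k >] then B k else set0 else set0.
have bC n : bianalytic (C n).
  rewrite /C; case: unpickle => [k|]; last exact: bianalytic0.
  by case: asboolP => [/bB//|_]; exact: bianalytic0.
have -> : \bigcup_(k in P) B k = \bigcup_n C n.
  apply/seteqP; split=> w [k Pk Bw].
    by exists (pickle k) => //; rewrite /C pickleK asboolT.
  move: Bw; rewrite /C; case: unpickle => [j|//].
  by case: asboolP => // Pj Bjw; exists j.
split; first by apply: analytic_bigcup => n; exact: (bC n).1.
by rewrite setC_bigcup; apply: analytic_bigcap => n; exact: (bC n).2.
Qed.

Lemma bianalytic_bigcap (I : countType) (P : set I) (B : I -> set (nat -> E)) :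
  (forall k, P k -> bianalytic (B k)) -> bianalytic (\bigcap_(k in P) B k).
Proof.
move=> bB; rewrite -[X in bianalytic X]setCK setC_bigcap.
by apply/bianalyticC/bianalytic_bigcup => k /bB; exact: bianalyticC.
Qed.

Lemma bianalyticU B C : bianalytic B -> bianalytic C -> bianalytic (B `|` C).
Proof.
move=> bB bC; rewrite -bigcup2E; apply: bianalytic_bigcup => -[|[|n]] _ //=.
exact: bianalytic0.
Qed.

Lemma bianalyticI B C : bianalytic B -> bianalytic C -> bianalytic (B `&` C).
Proof.
move=> bB bC; rewrite -[_ `&` _]setCK setCI.
by apply/bianalyticC/bianalyticU; exact: bianalyticC.
Qed.
End BianalyticSets.

Lemma bianalytic_comp (E E' : Type) (f : E' -> E) (B : set (nat -> E)) :
  bianalytic B -> bianalytic [set w | B (f \o w)].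
Proof.
suff aB C : analytic C -> analytic [set w : nat -> E' | C (f \o w)].
  by case=> aB1 aB2; split; [exact: (aB B)|exact: (aB (~` B))].
move=> [F [Fc CF]]; exists (fun w y => F (f \o w) y); split; last first.
  by move=> w; exact: CF.
move=> w y wy; apply: Fc => n; have [v [x [Fvx vw xy]]] := wy n.
by exists (f \o v), x; split => // i /vw /= ->.
Qed.

(** * Perfect schemes *)

Lemma countable_enum T (A : set T) : countable A ->
  exists f : nat -> option T, forall a, A a -> exists n, f n = Some a.
Proof.
move=> /countable_injP[g g_inj].
pose P n (o : option T) := forall a, A a -> g a = n -> o = Some a.
have /choice[f fP] n : exists o, P n o.
  have [[a [Aa gan]]|nA] := pselect (exists a, A a /\ g a = n).
    exists (Some a) => b Ab gbn; congr Some; apply: g_inj; rewrite ?inE//.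
    by rewrite gan.
  by exists None => b Ab gbn; case: nA; exists b.
by exists f => a Aa; exists (g a); exact: fP.
Qed.

Definition incompatible (u v : seq bool) := ~~ prefix u v && ~~ prefix v u.

(** [L'] continues [L] by one level of a perfect scheme: a sequence of lists, each splitting into
    the next, generates a perfect set of branches. *)
Definition splits (L L' : seq (seq bool)) := all (fun t =>
  has (fun u => has (fun v => [&& prefix t u, prefix t v & incompatible u v])
    L') L') L.

Lemma mkseq_prefix (z : nat -> bool) m n : m <= n -> prefix (mkseq z m) (mkseq z n).
Proof.
by move=> mn; apply/prefixP; exists (map z (iota m (n - m))); rewrite -map_cat -iotaD subnKC.
Qed.

Lemma prefix_nth (u v : seq bool) i : prefix u v -> i < size u ->
  nth false v i = nth false u i.
Proof. by case/prefixP=> w -> iu; rewrite nth_cat iu. Qed.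

Lemma prefix_branches (u v : seq bool) (z : nat -> bool) :
  u = mkseq z (size u) -> v = mkseq z (size v) -> ~~ incompatible u v.
Proof.
move=> -> ->; rewrite /incompatible negb_and !negbK.
by case: (leqP (size u) (size v)) => [/(mkseq_prefix z)|/ltnW/(mkseq_prefix z)] ->;
  rewrite ?orbT.
Qed.

(** Cantor's diagonal argument: of two incompatible extensions at most one is an initial segment
    of the [i]-th enumerated branch, so a branch can be steered away from it at stage [i]. *)
Lemma perfect_scheme_uncountable (T : set (seq bool)) (L : nat -> seq (seq bool)) :
  (forall t u, T (t ++ u) -> T t) ->
  L 0 = [:: [::]] -> (forall i, splits (L i) (L i.+1)) ->
  (forall i t, t \in L i -> T t) ->
  ~ countable [set z | forall n, T (mkseq z n)].
Proof.
move=> Tdown L0 Ls LT /countable_enum[f fP].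
have /choice[g gP] (it : nat * seq bool) : exists u, it.2 \in L it.1 ->
    [/\ u \in L it.1.+1, prefix it.2 u, size it.2 < size u &
      forall z, f it.1 = Some z -> u != mkseq z (size u)].
  case: it => i t /=; have [tL|] := boolP (t \in L i); last by exists [::].
  have /hasP[u uL /hasP[v vL /and3P[tu tv uv]]] := allP (Ls i) _ tL.
  have size_lt a b : prefix t a -> prefix t b -> ~~ prefix a b -> size t < size a.
    move=> ta tb; apply: contraNT; rewrite -leqNgt => at_.
    case/prefixP: ta at_ tb => c ->; rewrite size_cat -[leqRHS]addn0 leq_add2l.
    by rewrite leqn0 size_eq0 => /eqP->; rewrite cats0.
  have /andP[uv' vu'] := uv.
  have [[z [fz uz]]|nz] := pselect (exists z, f i = Some z /\ u == mkseq z (size u)).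
    exists v => _; split => //; first exact: (size_lt v u).
    move=> z'; rewrite fz => -[<-]; apply/negP => /eqP vz.
    by move: (prefix_branches (eqP uz) vz); rewrite uv.
  exists u => _; split => //; first exact: (size_lt u v).
  by move=> z fz; apply/negP => uz; apply: nz; exists z.
pose t := fix t i := if i is j.+1 then g (j, t j) else [::].
have tL i : t i \in L i.
  elim: i => [|i IH]; first by rewrite L0 inE.
  by have [] := gP (i, t i) IH.
have {}gP i := gP (i, t i) (tL i); simpl in gP.
have tS i : prefix (t i) (t i.+1) by have [] := gP i.
have tmon i j : i <= j -> prefix (t i) (t j).
  by move/subnK <-; elim: (j - i) => [|k IH]; [exact: prefix_refl|
    rewrite addSn; exact: prefix_trans IH (tS _)].
have tsize i : i <= size (t i).
  by elim: i => // i IH; have [_ _ ts _] := gP i; exact: leq_ltn_trans ts.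
pose z k := nth false (t k.+1) k.
have tz i : t i = mkseq z (size (t i)).
  apply: (@eq_from_nth _ false); first by rewrite size_mkseq.
  move=> k ki; rewrite nth_mkseq// /z.
  have [ik|ki'] := leqP i k.+1; first exact/esym/prefix_nth/ki/tmon.
  by apply: prefix_nth; [apply: tmon; exact: ltnW|exact: tsize].
have Tz n : T (mkseq z n).
  have /prefixP[u] := mkseq_prefix z (tsize n).
  by rewrite -tz => tnu; apply: (Tdown _ u); rewrite -tnu; exact: LT (tL n).
have [n fn] := fP _ Tz; have [_ _ _ /(_ _ fn)/eqP] := gP n.
by apply; exact: (tz n.+1).
Qed.

(** * Well-founded Cantor-Bendixson derivatives and the enumeration of countable sections *)

Definition branches (T : set (seq bool)) : set (nat -> bool) :=
  [set z | forall n, T (mkseq z n)].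

Section BoundedDerivatives.
Variables (E : countType) (F : (nat -> E * bool) -> (nat -> nat) -> Prop).
Hypothesis Fc : closed_relation F.
Hypothesis noscheme : forall w y (L : nat -> seq (seq bool)), F w y ->
  L 0 = [:: [::]] -> (forall i, splits (L i) (L i.+1)) ->
  ~ (forall i t, t \in L i.+1 -> (w (pickle t)).2).

Let node := seq (E * bool * nat * seq (seq bool)).

(** A node lists, for each [i] below its length, the [i]-th entries of a code and of a witness,
    and the [i]-th level of a perfect scheme.  The second component of a code entry is a bit: the
    bit at [pickle t] claims that [t] belongs to the tree.  A node is an attempt if its first
    components are still compatible with a point of [F] whose bits vouch for all the sequences of
    the scheme. *)
Definition attempt (s : node) :=
  path splits [:: [::]] (map snd s) /\
  exists w y, [/\ F w y, map fst s = mkseq (fun i => (w i, y i)) (size s) &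
    forall L t, L \in map snd s -> t \in L -> (w (pickle t)).2].

Definition extends (s r : node) := attempt s /\ exists e, s = rcons r e.

(** An infinite chain of attempts converges to a point of the closed set [F] together with a full
    perfect scheme vouched for by its bits, and [noscheme] forbids this.  The well-founded
    countable tree of attempts plays the part of the countable ordinal in the boundedness
    theorem. *)
Lemma extends_wf : well_founded extends.
Proof.
move=> r0; apply: contrapT => nr0.
have /choice[next nextP] (r : node) : exists s, ~ Acc extends r ->
    extends s r /\ ~ Acc extends s.
  have [r_acc|nr] := pselect (Acc extends r); first by exists r.
  have [s /not_implyP[sr ns]] : exists s, ~ (extends s r -> Acc extends s).
    by apply/existsNP => acc; apply: nr; constructor.
  by exists s.
pose r n := iter n next r0.
have nr n : ~ Acc extends (r n) by elim: n => // n IH; have [] := nextP _ IH.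
have ext n : extends (r n.+1) (r n) by have [] := nextP _ (nr n).
have att n : attempt (r n.+1) by have [] := ext n.
have rS n : exists e, r n.+1 = rcons (r n) e by have [] := ext n.
have [e0 _] := rS 0.
have sizer n : n <= size (r n).
  elim: n => // n IH; have [e ->] := rS n; by rewrite size_rcons.
have rmon m n i : m <= n -> i < size (r m) ->
    i < size (r n) /\ nth e0 (r n) i = nth e0 (r m) i.
  move=> /subnK <- im; elim: (n - m) => // k [ik IH].
  by rewrite addSn; have [e ->] := rS (k + m); rewrite size_rcons nth_rcons ik ltnW.
pose l i := nth e0 (r i.+1) i.
have rl n i : i < size (r n) -> nth e0 (r n) i = l i.
  move=> ir; rewrite /l; have [ni|ni] := leqP n i.+1.
    by have [_ ->] := rmon _ _ _ ni ir.
  by have [_ ->] := rmon _ _ _ (ltnW ni) (sizer i.+1).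
pose w i := (l i).1.1; pose y i := (l i).1.2.
have attP n : exists w' y', [/\ F w' y', agree n w' w, agree n y' y &
    forall i t, i < n -> t \in (l i).2 -> (w' (pickle t)).2].
  have [_ [w' [y' [Fwy e b]]]] := att n; exists w', y'.
  have wy i : i < n -> (w' i, y' i) = (l i).1.
    move=> /leqW /leq_trans /(_ (sizer n.+1)) ilt.
    have := congr1 (nth e0.1 ^~ i) e.
    by rewrite (nth_map e0)// nth_mkseq// rl// => ->.
  split => //.
  - by move=> i /wy; rewrite /w => <-.
  - by move=> i /wy; rewrite /y => <-.
  move=> i t ilt; apply: b; apply/mapP; exists (l i) => //.
  have {}ilt := leq_trans (leqW ilt) (sizer n.+1).
  by rewrite -(rl n.+1)// mem_nth.
have Fwy : F w y.
  by apply: Fc => n; have [w' [y' [? ? ? _]]] := attP n; exists w', y'.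
apply: (@noscheme w y (fun i => if i is j.+1 then (l j).2 else [:: [::]])) => //.
  move=> i; have ilt : i < size (r i.+1) by exact: sizer.
  have [/(pathP [:: [::]])/(_ i) + _] := att i.
  rewrite size_map => /(_ ilt); rewrite (nth_map e0)// rl//.
  case: i ilt => [|i] ilt //=; have i2 := ltnW ilt; rewrite (nth_map e0)//.
  by rewrite [nth _ _ i](rl i.+2).
move=> i t tl.
have [w' [y' [_ ww _ /(_ i t)]]] := attP (maxn i.+1 (pickle t).+1).
by rewrite leq_max leqnn => /(_ isT tl); rewrite ww// leq_max leqnn orbT.
Qed.

(** The Cantor-Bendixson derivative on trees: a sequence survives if the tree still branches
    above it. *)
Definition derivative (T : set (seq bool)) : set (seq bool) :=
  [set t | exists u v, [/\ T u, T v, prefix t u, prefix t v & incompatible u v]].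

Variable T : set (seq bool).

(** The derivative of [T] at a node [s] is the intersection of [T] with the derivatives of the
    derivatives at the children of [s].  The well-foundedness of the tree of attempts makes this
    a transfinite iteration; as the operator is monotone, it can be given as an inductive
    predicate, and well-foundedness serves only in proofs. *)
Inductive iterated_derivative : node -> set (seq bool) :=
  IteratedDerivative s t of T t &
    (forall r, extends r s -> exists u v,
      [/\ iterated_derivative r u, iterated_derivative r v,
          prefix t u, prefix t v & incompatible u v]) :
    iterated_derivative s t.

Lemma iterated_derivativeE s t : iterated_derivative s t <->
  T t /\ forall r, extends r s -> derivative (iterated_derivative r) t.
Proof. by split=> [[]//|[Tt Dt]]; constructor. Qed.

Variables (w : nat -> E * bool) (y : nat -> nat).
Hypothesis Fwy : F w y.
Hypothesis bit_w : forall t, T t -> (w (pickle t)).2.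

(** Let [s] agree with a point of [F].  If the iterated derivative at [s] branched above every
    sequence of the last level of [s], incompatible extensions within it would form a further level,
    hence a child [r] of [s].  By definition of the iterated derivative at [s], the one at [r]
    branches above every sequence of this new level, and so on down the well-founded tree. *)
Lemma derivative_dies (s : node) :
  path splits [:: [::]] (map snd s) ->
  map fst s = mkseq (fun i => (w i, y i)) (size s) ->
  (forall L t, L \in map snd s -> t \in L -> T t) ->
  ~ (forall t, t \in last [:: [::]] (map snd s) -> derivative (iterated_derivative s) t).
Proof.
elim: {s}(extends_wf s) => s _ IH spl sw sT Ds.
have /choice[g gP] t : exists uv : seq bool * seq bool,
    t \in last [:: [::]] (map snd s) ->
    [/\ iterated_derivative s uv.1, iterated_derivative s uv.2,
        prefix t uv.1, prefix t uv.2 & incompatible uv.1 uv.2].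
  have [/Ds[u [v uv]]|] := boolP (t \in last [:: [::]] (map snd s)).
    by exists (u, v).
  by exists ([::], [::]).
pose L := flatten [seq [:: (g t).1; (g t).2] | t <- last [:: [::]] (map snd s)].
have Ls u : u \in L -> iterated_derivative s u.
  move=> /flatten_mapP[t /gP[s1 s2 _ _ _]]; rewrite !inE.
  by case/orP => /eqP->.
pose r := rcons s (w (size s), y (size s), L).
have rT M t : M \in map snd r -> t \in M -> T t.
  rewrite /r map_rcons mem_rcons inE => /orP[/eqP-> /= /Ls /iterated_derivativeE[]//|].
  exact: sT.
have rspl : path splits [:: [::]] (map snd r).
  rewrite /r map_rcons rcons_path spl/=; apply/allP => t ts.
  have [_ _ tu tv uv] := gP _ ts.
  apply/hasP; exists (g t).1; first by apply/flatten_mapP; exists t; rewrite ?inE ?eqxx.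
  apply/hasP; exists (g t).2; last exact/and3P.
  by apply/flatten_mapP; exists t; rewrite ?inE ?eqxx ?orbT.
have rw : map fst r = mkseq (fun i => (w i, y i)) (size r).
  by rewrite /r map_rcons sw size_rcons mkseqS.
have rs : extends r s.
  split; last by exists (w (size s), y (size s), L).
  split => //; exists w, y; split => // M t Mr tM; exact/bit_w/(rT M).
apply: (IH r) => // t.
by rewrite /r map_rcons last_rcons => /Ls /iterated_derivativeE[_]; exact.
Qed.

(** If no stage separated [z] from its neighbours, [z] would remain a branch of every iterated
    derivative, and all derivatives would contain the empty sequence, contrary to
    [derivative_dies] at the empty node. *)
Lemma branch_isolated z : branches T z -> exists s n,
  branches (iterated_derivative s) z /\
  ~ derivative (iterated_derivative s) (mkseq z n).
Proof.
move=> Tz; apply: contrapT => H.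
have all_der s : branches (iterated_derivative s) z.
  elim: {s}(extends_wf s) => s _ IH n; apply/iterated_derivativeE; split => // r /IH rz.
  by apply: contrapT => nD; apply: H; exists r, n; split => //; exact: rz.
apply: (@derivative_dies [::]) => // t /=; rewrite inE => /eqP->.
by apply: contrapT => nD; apply: H; exists [::], 0; split => //; exact: all_der.
Qed.

(** Above a sequence outside the derivative a tree is linearly ordered, so an isolated branch is
    read off from any sequences of the tree that are long enough. *)
Lemma branch_isolated_def z s n : 
  branches (iterated_derivative s) z ->
  ~ derivative (iterated_derivative s) (mkseq z n) ->
  forall k, z k <-> exists u, [/\ iterated_derivative s u, prefix (mkseq z n) u & nth false u k].
Proof.
move=> sz nD k; pose v := mkseq z (maxn n k.+1).
have nv : prefix (mkseq z n) v by apply: mkseq_prefix; rewrite leq_maxl.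
have vk : nth false v k = z k by rewrite nth_mkseq// leq_max leqnn orbT.
split=> [zk|[u [su nu uk]]]; first by exists v; rewrite vk; split => //; exact: sz.
have ku : k < size u by rewrite ltnNge; apply: contraTN uk => /(nth_default _)->.
have kv : k < size v by rewrite size_mkseq leq_max leqnn orbT.
have : ~~ incompatible u v by apply/negP => uv; apply: nD; exists u, v; split => //; exact: sz.
rewrite negb_and !negbK -vk => /orP[/prefix_nth/(_ ku)->//|/prefix_nth/(_ kv)<-//].
Qed.

End BoundedDerivatives.

Section Enumeration.
Context d (X : measurableType d) (E : countType).
Variables (V : set X) (T : X -> set (seq bool)).
Variables (D : set (nat -> E)) (p : (nat -> E) -> X).

(** The Lusin-Novikov theorem for closed sections: if the tree [T x] depends measurably on [x] and
    has countably many branches for [x] in [V], then these branches are enumerated by measurable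
    functions.  The space [X] is only assumed to be parametrized over [V] by a set [D] of
    sequences along which measurable sets pull back to bianalytic ones.  The enumeration is
    indexed by a node of the tree of attempts and a sequence above which the branch is isolated
    in the iterated derivative at that node. *)
Lemma measurable_enumeration :
  measurable V ->
  (forall t, measurable [set x | T x t]) ->
  (forall x t u, T x (t ++ u) -> T x t) ->
  (forall A, measurable A -> bianalytic (D `&` p @^-1` A)) ->
  V `<=` p @` D ->
  (forall x, V x -> countable (branches (T x))) ->
  exists e : nat -> X -> set nat,
    [/\ forall j k, measurable [set x | e j x k],
        forall j x, e j x = set0 \/ branches (T x) (fun k => `[< e j x k >]) &
        forall x z, V x -> branches (T x) z -> exists j, e j x = [set k | z k] ].
Proof.
move=> mV mT Tdown pA pV Tcount.
(* The bits of a code may claim too little but not too much; this suffices to exclude perfect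
   schemes, while a code with all correct bits is used for enumerating. *)
pose Z := [set w : nat -> E * bool | (D `&` p @^-1` V) (fst \o w)] `&`
  \bigcap_t (~` [set w : nat -> E * bool | (w (pickle t)).2] `|`
    [set w | (D `&` p @^-1` [set x | T x t]) (fst \o w)]).
have [[F [Fc ZF]] _] : bianalytic Z.
  apply: bianalyticI; first exact/bianalytic_comp/pA.
  apply: bianalytic_bigcap => t _; apply: bianalyticU; last exact/bianalytic_comp/pA.
  apply: bianalyticC; apply: bianalytic_locally_constant => w.
  by exists (pickle t).+1 => v vw; rewrite /= vw.
have noscheme w y (L : nat -> seq (seq bool)) : F w y ->
    L 0 = [:: [::]] -> (forall i, splits (L i) (L i.+1)) ->
    ~ (forall i t, t \in L i.+1 -> (w (pickle t)).2).
  move=> Fwy L0 LS Lw.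
  have [[Dw Vw] Tw] : Z w by apply/ZF; exists y.
  have LT i t : t \in L i.+1 -> T (p (fst \o w)) t.
    by move=> /Lw wt; have [//|[]] := Tw t I.
  apply: (perfect_scheme_uncountable (Tdown (p (fst \o w))) L0 LS) _ (Tcount _ Vw).
  case=> [t|i t]; last exact: LT.
  rewrite L0 inE => /eqP->.
  have /allP/(_ [::]) := LS 0; rewrite L0 inE eqxx => /(_ isT)/hasP[u uL _].
  exact: (Tdown _ [::] u) (LT _ _ uL).
pose node : countType := seq (E * bool * nat * seq (seq bool)).
pose R x (s : node) := iterated_derivative F (T x) s.
have mR s t : measurable [set x | R x s t].
  elim: {s}(extends_wf Fc noscheme s) t => s _ IH t.
  apply: (mpred_ext (fun x => iff_sym (iterated_derivativeE F (T x) s t))).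
  apply: mpred_and; first exact: mT.
  apply: mpred_forall => r.
  have [rs|nrs] := pselect (extends F r s); last by apply: mpred_ext (mpred_cst X True) => x; split.
  apply: mpred_imply; first exact: mpred_cst.
  apply: mpred_exists => u; apply: mpred_exists => v.
  apply: mpred_ext (mpred_and (mpred_and (IH _ rs u) (IH _ rs v))
    (mpred_cst X [/\ prefix t u, prefix t v & incompatible u v])) => x.
  by split=> [[[? ?] []]|[? ? ? ? ?]].
pose e0 (st : node * seq bool) x := [set k | exists u,
  [/\ R x st.1 u, prefix st.2 u & nth false u k]].
have me0 st k : measurable [set x | e0 st x k].
  apply: mpred_exists => u.
  apply: mpred_ext (mpred_and (mR st.1 u)
    (mpred_cst X (prefix st.2 u /\ nth false u k))) => x.
  by split=> [[? []]|[]].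
pose ok st := [set x | branches (T x) (fun k => `[< e0 st x k >])].
have mok st : measurable (ok st).
  apply: mpred_forall => n.
  have : measurable_pred (fun x => exists t : seq bool, [/\ size t = n, T x t &
      forall k : 'I_n, nth false t k <-> e0 st x k]).
    apply: mpred_exists => t.
    apply: mpred_ext (mpred_and (mpred_cst X (size t = n)) (mpred_and (mT t)
      (mpred_forall (fun k : 'I_n => mpred_iff (mpred_cst X (nth false t k)) (me0 st k))))) => x.
    by split=> [[? []]|[]].
  apply: mpred_ext => x; split=> [[t [tn Tt et]]|Tx].
    suff -> : mkseq (fun k => `[< e0 st x k >]) n = t by [].
    apply: (@eq_from_nth _ false); rewrite size_mkseq// => k kn.
    rewrite nth_mkseq// -[RHS]asboolb; apply: asbool_equiv_eq; apply: iff_sym.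
    exact: (et (Ordinal kn)).
  exists (mkseq (fun k => `[< e0 st x k >]) n); split => //; first by rewrite size_mkseq.
  by move=> k; rewrite nth_mkseq//; split=> /asboolP.
pose e n x := if (unpickle n : option (node * seq bool)) is Some st then
  [set k | ok st x /\ e0 st x k] else set0.
exists e; split.
- move=> j k; rewrite /e; case: unpickle => [st|]; last exact: measurable0.
  exact: (mpred_and (mok st) (me0 st k)).
- move=> j x; rewrite /e; case: unpickle => [st|]; last by left.
  have [xok|xok] := pselect (ok st x); last by left; apply/seteqP; split=> k // [].
  right; suff -> : (fun k => `[< [set k | ok st x /\ e0 st x k] k >]) =
    (fun k => `[< e0 st x k >]) by [].
  by apply/funext => k; apply/asbool_equiv_eq; split=> // -[].
- move=> x z Vx Tz.
  have [w Dw pw] := pV _ Vx.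
  pose w' i := (w i, if unpickle i is Some t then `[< T x t >] else false).
  have [y Fwy] : exists y, F w' y.
    apply/ZF; split; first by split; rewrite //= pw.
    move=> t _; rewrite /setU /setC /mkset /w' pickleK /=.
    case: asboolP => Tt; last by left.
    by right; split => //=; rewrite pw.
  have bit t : T x t -> (w' (pickle t)).2 by rewrite /w' pickleK => Tt; apply/asboolP.
  have [s [n [sz nD]]] := branch_isolated Fc noscheme Fwy bit Tz.
  pose st := (s, mkseq z n).
  have est : e0 st x = [set k | z k].
    by apply/seteqP; split=> k /= /(branch_isolated_def sz nD).
  exists (pickle st); rewrite /e pickleK.
  have xok : ok st x.
    rewrite /ok /= est; suff -> : (fun k => `[< [set k | z k] k >]) = z by [].
    by apply/funext => k; exact: asboolb.
  by rewrite -est; apply/seteqP; split=> k // [].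
Qed.

End Enumeration.

Local Open Scope group_scope.

(** * The topology of Sinf and the Effros structure *)

Lemma prod_topology_cvg I (T : I -> topologicalType)
    (F : set_system (prod_topology T)) (f : prod_topology T) : Filter F ->
  (forall i, (fun g : prod_topology T => g i) @ F --> f i) -> F --> f.
Proof.
move=> FF Ff; apply/cvg_sup => i A [_ [[W oW <-] Wf] /filterS]; apply.
by apply: (Ff i); exact: open_nbhs_nbhs.
Qed.

Definition pointwise (a b : seq nat) : set Sinf := [set g | map g a = b].

Lemma map_ext_iota (f g : nat -> nat) n :
  map f (iota 0 n) = map g (iota 0 n) <-> agree n f g.
Proof.
split=> [/eq_in_map fg i ilt|fg]; first by apply: fg; rewrite mem_iota.
by apply/eq_in_map => i; rewrite mem_iota => /andP[_]; exact: fg.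
Qed.

Lemma nbhs_Sinf (U : set Sinf) (g : Sinf) : nbhs g U <->
  exists n, forall h : Sinf, agree n h g -> U h.
Proof.
split=> [[V [[W oW WV] Vg] VU]|[n nU]].
  pose F : set_system {ptws nat -> nat} :=
    [set A | exists n, forall h : nat -> nat, agree n h g -> A h].
  have FF : Filter F.
    split; first by exists 0.
      move=> P Q [m mP] [n nQ]; exists (maxn m n) => h hg.
      by split; [apply: mP|apply: nQ] => i ilt; apply: hg; rewrite leq_max ilt ?orbT.
    by move=> P Q PQ [m mP]; exists m => h /mP/PQ.
  have Fg : F --> (\val g : {ptws nat -> nat}).
    apply: prod_topology_cvg => i A /nbhs_singleton Ai.
    by exists i.+1 => h hg; rewrite /= hg.
  have [|n nW] := Fg W; first by apply: open_nbhs_nbhs; split => //; rewrite -WV in Vg.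
  by exists n => h hg; apply: VU; rewrite -WV; exact: nW.
apply: filterS nU _; elim: n => [|n IH]; first exact: filterS filterT.
have evn : nbhs g [set h : Sinf | h n = g n].
  have ev_cont : continuous (fun h : Sinf => (\val h : {ptws nat -> nat}) n).
    move=> h; apply: (@continuous_comp _ _ _ _ (fun f : {ptws nat -> nat} => f n)).
      exact: initial_continuous.
    exact: (@proj_continuous _ (fun=> nat)).
  apply: (ev_cont g [set k | k = g n]); apply: open_nbhs_nbhs; split => //.
  exact: discrete_open.
apply: filterS2 IH evn => h hg hn i; rewrite ltnS leq_eqVlt => /orP[/eqP->//|].
exact: hg.
Qed.

Lemma map_agree (a : seq nat) : exists n, forall f g : nat -> nat, agree n f g ->
  map f a = map g a.
Proof.
exists (\max_(i <- a) i).+1 => f g fg; apply/eq_in_map => i ia; apply: fg.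
by rewrite ltnS; exact: (@leq_bigmax_seq nat a xpredT id i).
Qed.

Lemma pointwise_open a b : open (pointwise a b).
Proof.
rewrite openE => g /= gb; apply/nbhs_Sinf; have [n nP] := map_agree a.
by exists n => h /nP; rewrite /pointwise /= => ->.
Qed.

Lemma open_Sinf (U : set Sinf) : open U <-> forall g, U g ->
  exists n, forall h : Sinf, agree n h g -> U h.
Proof.
by rewrite openE; split=> UP g /UP /nbhs_Sinf.
Qed.

Lemma closed_Sinf (C : set Sinf) : closed C <-> forall g : Sinf,
  (forall n, exists2 h : Sinf, C h & agree n h g) -> C g.
Proof.
rewrite -openC open_Sinf; split=> CP g.
  move=> gC; apply: contrapT => /CP[n nC]; have [h Ch /nC] := gC n; exact.
move=> nCg; apply: contrapT => H; apply: nCg; apply: CP => n.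
apply: contrapT => nh; apply: H; exists n => h hg Ch; apply: nh; by exists h.
Qed.

Lemma closed_subsetP (G : closed_subset) (g : Sinf) :
  (forall n, exists2 h : Sinf, (G : set Sinf) h & agree n h g) -> (G : set Sinf) g.
Proof. by move: g; apply/closed_Sinf; exact: (set_mem (valP G)). Qed.

(** The generating events of the Effros structure.  All the Borel conditions on closed sets
    below are built from hits of the clopen sets [pointwise a b] and of their intersections. *)
Definition hits (O : set Sinf) (G : closed_subset) := (G : set Sinf) `&` O !=set0.

Lemma hits_measurable O : open O -> measurable_pred (hits O : effros -> Prop).
Proof. by move=> oO; apply: sub_sigma_algebra; exists O => //=; exact: oO. Qed.

Lemma hits1_measurable a b : measurable_pred (hits (pointwise a b) : effros -> Prop).
Proof. by apply: hits_measurable; exact: pointwise_open. Qed.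

Lemma hits2_measurable a b c d :
  measurable_pred (hits (pointwise a b `&` pointwise c d) : effros -> Prop).
Proof. by apply: hits_measurable; apply: openI; exact: pointwise_open. Qed.

(** * Coding closed sets by dense sequences *)

Section Decoding.
Implicit Types w : nat -> nat * nat.

(** A code lists the values of a sequence of permutations and of their inverses.  Including the
    inverses makes the set of valid codes easy to define and each decoded function bijective. *)
Definition code_fun w (k m : nat) := (w (pickle (k, m))).1.
Definition code_inv w (k m : nat) := (w (pickle (k, m))).2.

Definition valid_code : set (nat -> nat * nat) :=
  [set w | forall k, cancel (code_fun w k) (code_inv w k) /\
                     cancel (code_inv w k) (code_fun w k)].

Definition decode_set w : set Sinf :=
  [set g | forall n, exists k, agree n (code_fun w k) g].

Lemma decode_closed w : closed (decode_set w).
Proof.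
apply/closed_Sinf => g gP n; have [h hw hg] := gP n.
by have [k kh] := hw n; exists k => i ilt; rewrite kh ?hg.
Qed.

Definition decode w : closed_subset :=
  exist _ (decode_set w) (mem_set (@decode_closed w)).

Lemma bianalytic_valid_code : bianalytic valid_code.
Proof.
have -> : valid_code = \bigcap_km
    [set w | code_inv w km.1 (code_fun w km.1 km.2) = km.2 /\
             code_fun w km.1 (code_inv w km.1 km.2) = km.2].
  apply/seteqP; split=> w H; first by move=> [k m] _; have [] := H k.
  by move=> k; split=> m; have [] := H (k, m) I.
apply: bianalytic_bigcap => -[k m] _; apply: bianalytic_locally_constant => w.
pose n (a : nat) := (pickle (k, a) : nat).+1.
exists (maxn (n m) (maxn (n (code_fun w k m)) (n (code_inv w k m)))) => v vw.
rewrite /= /code_fun /code_inv !vw //; rewrite !leq_max ?leqnn ?orbT //.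
Qed.

Definition code_perm w (wP : valid_code w) k : Sinf :=
  Sinf_of (Bijective (wP k).1 (wP k).2).

Lemma bianalytic_decode_hits (U : set Sinf) : open U ->
  bianalytic (valid_code `&` [set w | hits U (decode w)]).
Proof.
move=> oU.
have -> : valid_code `&` [set w | hits U (decode w)] = valid_code `&`
   \bigcup_(kb in [set kb : nat * seq nat |
                    pointwise (iota 0 (size kb.2)) kb.2 `<=` U])
     [set w | map (code_fun w kb.1) (iota 0 (size kb.2)) = kb.2].
  apply/seteqP; split=> w [wP].
    move=> [g [gw Ug]]; split => //; have [n nU] := (open_Sinf U).1 oU _ Ug.
    have [k kg] := gw n; exists (k, map g (iota 0 n)) => /=.
      by move=> h; rewrite size_map size_iota /pointwise /= => /map_ext_iota; exact: nU.
    by rewrite size_map size_iota; exact/map_ext_iota.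
  move=> [[k b] /= bU wb]; split => //; exists (code_perm wP k); split; last exact: bU.
  by move=> n; exists k.
apply: bianalyticI; first exact: bianalytic_valid_code.
apply: bianalytic_bigcup => -[k b] _ /=; apply: bianalytic_locally_constant => w.
exists (\max_(i < size b) (pickle (k, i : nat)).+1) => v vw /=.
suff -> : map (code_fun v k) (iota 0 (size b)) = map (code_fun w k) (iota 0 (size b)) by [].
apply/map_ext_iota => i ib; rewrite /code_fun vw//.
exact: (@leq_bigmax _ (fun i : 'I_(size b) => (pickle (k, i : nat)).+1) (Ordinal ib)).
Qed.

(** On valid codes, hitting an open set is a countable union of clopen conditions, and the
    bianalytic sets form a sigma-algebra. *)
Lemma bianalytic_decode (A : set effros) : measurable A ->
  bianalytic (valid_code `&` (decode : _ -> effros) @^-1` A).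
Proof.
suff : <<s effros_generators >> `<=` [set A : set closed_subset |
    bianalytic (valid_code `&` decode @^-1` A)] by move=> /(_ A).
apply: smallest_sub; last first.
  by move=> _ [U oU <-]; exact: bianalytic_decode_hits.
split; rewrite /mkset.
- by rewrite preimage_set0 setI0; exact: bianalytic0.
- move=> B bB; rewrite setTD preimage_setC.
  have -> : valid_code `&` ~` (decode @^-1` B) =
     valid_code `&` ~` (valid_code `&` decode @^-1` B).
    by rewrite setCI setIUr setICr set0U.
  by apply: bianalyticI; [exact: bianalytic_valid_code|exact: bianalyticC].
- move=> B bB; rewrite preimage_bigcup setI_bigcupr.
  by apply: bianalytic_bigcup => k _; exact: bB.
Qed.

Lemma decode_surj (G : closed_subset) : (G : set Sinf) !=set0 ->
  exists2 w, valid_code w & decode w = G.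
Proof.
move=> [g0 Gg0].
have /choice[h hP] (b : seq nat) : exists h : Sinf, (G : set Sinf) h /\
    forall g : Sinf, (G : set Sinf) g -> map g (iota 0 (size b)) = b ->
    map h (iota 0 (size b)) = b.
  have [[h [Gh hb]]|nh] := pselect (exists h : Sinf, (G : set Sinf) h /\
      map h (iota 0 (size b)) = b); first by exists h.
  by exists g0; split => // g Gg gb; case: nh; exists g.
pose d k : Sinf := if unpickle k is Some b then h b else g0.
pose w i := if unpickle i is Some (k, m) then (d k m, Sinf_inv (d k) m) else (0, 0).
have wE k m : w (pickle (k, m)) = (d k m, Sinf_inv (d k) m) by rewrite /w pickleK.
exists w.
  move=> k; rewrite /code_fun /code_inv.
  by split=> m; rewrite !wE /=; [exact: Sinf_funK|exact: Sinf_invK].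
apply/val_inj/seteqP; split=> g /=.
  move=> gw; apply: closed_subsetP => n; have [k kg] := gw n; exists (d k).
    by rewrite /d; case: unpickle => [b|//]; have [] := hP b.
  by move=> i /kg <-; rewrite /code_fun wE.
move=> Gg n; pose b := map g (iota 0 n).
have sb : size b = n by rewrite size_map size_iota.
exists (pickle b) => i ilt; rewrite /code_fun wE /= /d pickleK.
have [_ /(_ g Gg)] := hP b; rewrite sb => /(_ erefl)/map_ext_iota; exact.
Qed.

End Decoding.

(** * The tree of open cosets of bounded level *)

Lemma map_mulg (x y : Sinf) a : map (x * y : Sinf) a = map x (map y a).
Proof. by rewrite -map_comp. Qed.

Lemma map_mulKg (x : Sinf) a : map ((x^-1)%g : Sinf) (map x a) = a.
Proof. by rewrite -map_mulg mulVg map_id. Qed.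

Lemma agree_mull (x y z : Sinf) n : agree n y z -> agree n (x * y : Sinf) (x * z : Sinf).
Proof. by move=> yz i /yz yi; exact: (congr1 x yi). Qed.

(** A nonempty set closed under [x * y^-1 * z] is a left coset of a subgroup.  The empty set is
    admitted so that the definition consists of closed conditions. *)
Definition open_coset (G A : set Sinf) := [/\ A `<=` G,
  forall g, A g -> exists n, forall h, G h -> agree n h g -> A h &
  forall x y z, A x -> A y -> A z -> A (x * y^-1 * z)].

(** Openness of a coset is uniform: if an element [x] has a neighbourhood of level [n] inside [A],
    translating by [g * x^-1] gives one of the same level at every [g] in [A]. *)
Lemma open_coset_level G A : subgroup G -> open_coset G A ->
  exists n, forall g h, A g -> G h -> agree n h g -> A h.
Proof.
move=> [G1 GM GV] [AG oA triple].
have [[x Ax]|nA] := pselect (A !=set0); last by exists 0 => g h Ag; case: nA; exists g.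
have [n nA] := oA x Ax; exists n => g h Ag Gh hg.
rewrite -[h](mulVKg g) -[g^-1 * h](mulKg x) mulgA.
apply: (triple) => //; apply: (nA).
  by apply: (GM); [exact: AG|apply: (GM) => //; apply/GV/AG].
have := @agree_mull x (g^-1 * h) 1 n; rewrite mulg1; apply => i /hg hgi.
exact: etrans (congr1 ((g^-1)%g : Sinf) hgi) (congr1 (fun s : Sinf => s i) (mulVg g)).
Qed.

Lemma open_coset0 G : open_coset G set0.
Proof. by split => // x []. Qed.

(** A set of left cosets of the stabilizer of [0, ..., n-1] given by the images of the tuple
    [iota 0 n], each coded as a number. *)
Definition coset_of n (s : set nat) (G : set Sinf) : set Sinf :=
  [set g | G g /\ s (pickle (map g (iota 0 n)))].

Lemma coset_of0 n G : coset_of n set0 G = set0.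
Proof. by apply/seteqP; split=> g []. Qed.

(** The finite approximations to codes of open cosets of level [n].  If [a], [b], [c] are the images
    of [iota 0 n] under [x], [y], [z], then [d] is its image under [x * y^-1 * z], where
    [e] is the image under [y^-1 * z].  Only conclusions [d] that the approximation has
    reached are required, so that the tree is closed under initial segments. *)
Definition coset_tree n (G : closed_subset) : set (seq bool) := [set t |
  (forall k, nth false t k -> exists b, pickle b = k /\
     hits (pointwise (iota 0 n) b) G) /\
  forall a b c d : seq nat, nth false t (pickle a) -> nth false t (pickle b) ->
    nth false t (pickle c) -> pickle d < size t ->
    (exists e, hits (pointwise (iota 0 n) a `&` pointwise e d) G /\
               hits (pointwise (iota 0 n) b `&` pointwise e c) G) ->
    nth false t (pickle d)].

Lemma coset_tree_measurable n t : measurable_pred ((coset_tree n)^~ t : effros -> Prop).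
Proof.
apply: mpred_and.
  apply: mpred_forall => k; apply: mpred_imply; first exact: mpred_cst.
  apply: mpred_exists => b; apply: mpred_and; first exact: mpred_cst.
  exact: hits1_measurable.
do 4!apply: mpred_forall => ?.
do 4!(apply: mpred_imply; first exact: mpred_cst).
apply: mpred_imply; last exact: mpred_cst.
by apply: mpred_exists => e; apply: mpred_and; exact: hits2_measurable.
Qed.

Lemma coset_tree_prefix n G t u : coset_tree n G (t ++ u) -> coset_tree n G t.
Proof.
have nt k : nth false t k -> nth false (t ++ u) k.
  by rewrite nth_cat; case: ltnP => // tk; rewrite nth_default.
move=> [t1 t2]; split=> [k /nt /t1//|a b c d /nt ta /nt tb /nt tc dt e].
have := t2 a b c d ta tb tc; rewrite size_cat nth_cat dt; apply => //.
exact: ltn_addr.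
Qed.

Lemma branches_coset_tree n G z : branches (coset_tree n G) z <->
  (forall k, z k -> exists b, pickle b = k /\ hits (pointwise (iota 0 n) b) G) /\
  forall a b c d : seq nat, z (pickle a) -> z (pickle b) -> z (pickle c) ->
    (exists e, hits (pointwise (iota 0 n) a `&` pointwise e d) G /\
               hits (pointwise (iota 0 n) b `&` pointwise e c) G) ->
    z (pickle d).
Proof.
have nz N k : nth false (mkseq z N) k = (k < N) && z k.
  by case: ltnP => kN; [rewrite nth_mkseq|rewrite nth_default ?size_mkseq].
split=> [zT|[z1 z2] N].
  split=> [k zk|a b c d za zb zc e].
    by have [/(_ k) + _] := zT k.+1; rewrite nz leqnn; exact.
  pose N := maxn (maxn (pickle a) (pickle b)) (maxn (pickle c) (pickle d)).
  have [_ /(_ a b c d)] := zT N.+1; rewrite !nz size_mkseq !ltnS !leq_max.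
  by rewrite !leqnn !orbT za zb zc /=; apply.
split=> [k|a b c d]; rewrite !nz; first by case/andP => _; exact: z1.
rewrite size_mkseq => /andP[_ za] /andP[_ zb] /andP[_ zc] -> /=; exact: z2.
Qed.

Lemma branch_open_coset n (G : closed_subset) z : subgroup G ->
  branches (coset_tree n G) z -> open_coset G (coset_of n [set k | z k] G).
Proof.
move=> [G1 GM GV] /branches_coset_tree[_ z2]; split=> [g []//|g [Gg zg]|x y w].
  exists n => h Gh /map_ext_iota hg; split => //; by rewrite hg.
move=> [Gx zx] [Gy zy] [Gw zw]; split.
  by apply: (GM) => //; apply: (GM) => //; exact: GV.
apply: (z2 _ _ _ _ zx zy zw); exists (map ((y^-1 * w)%g : Sinf) (iota 0 n)); split.
  by exists x; split => //; split => //; rewrite /pointwise /= -map_mulg mulgA.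
by exists y; split => //; split => //; rewrite /pointwise /= -map_mulg mulVKg.
Qed.

Lemma open_coset_branch (G : closed_subset) A : subgroup G -> open_coset G A ->
  exists n z, branches (coset_tree n G) z /\ coset_of n [set k | z k] G = A.
Proof.
move=> sG cA; have [n nA] := open_coset_level sG cA.
have [AG _ triple] := cA.
pose P k := exists2 g : Sinf, A g & pickle (map g (iota 0 n)) = k.
have PA (g : Sinf) : (G : set Sinf) g -> P (pickle (map g (iota 0 n))) -> A g.
  move=> Gg [h Ah /(pcan_inj pickleK)/esym/map_ext_iota]; exact: nA.
exists n, (fun k => `[< P k >]); split.
  apply/branches_coset_tree; split=> [k /asboolP[g Ag <-]|a b c d].
    by exists (map g (iota 0 n)); split => //; exists g; split => //; exact: AG.
  move=> /asboolP Pa /asboolP Pb /asboolP[w Aw /(pcan_inj pickleK) wc].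
  move=> [e [[x [Gx [xa xe]]] [y [Gy [yb ye]]]]]; apply/asboolP.
  exists (x * y^-1 * w).
    by apply: (triple) => //; apply: PA => //; rewrite ?xa ?yb.
  by rewrite !map_mulg wc -ye map_mulKg xe.
apply/seteqP; split=> g /=; first by move=> [Gg /asboolP]; exact: PA.
by move=> Ag; split; [exact: AG|apply/asboolP; exists g].
Qed.

Lemma coset_of_inj n (G : closed_subset) z z' :
  branches (coset_tree n G) z -> branches (coset_tree n G) z' ->
  coset_of n [set k | z k] G = coset_of n [set k | z' k] G -> z = z'.
Proof.
suff sub x y : branches (coset_tree n G) x ->
    coset_of n [set k | x k] G = coset_of n [set k | y k] G -> forall k, x k -> y k.
  move=> zT z'T zz'; apply/funext => k.
  by apply/idP/idP; [exact: (sub z z' zT zz')|exact: (sub z' z z'T (esym zz'))].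
move=> /branches_coset_tree[x1 _] xy k xk; have [b [bk [g [Gg gb]]]] := x1 _ xk.
have : coset_of n [set k | x k] G g by split => //=; rewrite gb bk.
by rewrite xy => -[_ /=]; rewrite gb bk.
Qed.

(** A nonempty open coset is determined by its stabilizer [U] and the image of a sufficiently long
    initial segment under one of its elements. *)
Lemma countable_open_cosets (G : set Sinf) : subgroup G ->
  countable (open_subgroups G) -> countable [set A | open_coset G A].
Proof.
move=> sG cG; have [G1 GM GV] := sG.
pose F (Ub : set Sinf * option (seq nat)) : set Sinf :=
  if Ub.2 is Some b then [set h | G h /\
    exists g : Sinf, [/\ G g, map g (iota 0 (size b)) = b & Ub.1 (g^-1 * h)]]
  else set0.
apply: (@sub_countable _ _ _ (F @` (open_subgroups G `*` setT))); last first.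
  apply: sub_countable (card_image_le _ _) _.
  by apply: countableX => //; exact: countableP.
apply: subset_card_le => A cA; have [AG oA triple] := cA.
have [[x Ax]|nA] := pselect (A !=set0); last first.
  exists (G, None) => /=; last by apply/seteqP; split=> g // Ag; apply: nA; exists g.
  by split => //; split => //=; exists setT; [exact: openT|rewrite setIT].
have [n nA] := open_coset_level sG cA.
exists ([set u | A (x * u)], Some (map x (iota 0 n))).
  split => //=; split.
  - split=> /=; first by rewrite mulg1.
      move=> u v Au Av; have := triple _ _ _ Au Ax Av.
      by rewrite -!mulgA (mulgA x^-1) mulVg mul1g.
    move=> u Au; have := triple _ _ _ Ax Au Ax.
    by rewrite invgM mulgA mulgVK.
  - by move=> u /AG; move/(GM _ _ (GV _ (AG _ Ax))); rewrite mulKg.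
  - exists [set h : Sinf | exists2 u : Sinf, A (x * u) & agree n h u].
      apply/open_Sinf => h [u Au hu]; exists n => h' hh'; exists u => //.
      by move=> i ilt; rewrite hh'// hu.
    apply/seteqP; split=> h /=.
      move=> Axh; split; last by exists h.
      by move: (AG _ Axh) => /(GM _ _ (GV _ (AG _ Ax))); rewrite mulKg.
    move=> [Gh [u Au hu]]; apply: nA Au _ _; first by apply: (GM) => //; exact: AG.
    exact: agree_mull.
apply/seteqP; split=> h /=.
  move=> [Gh [g [Gg]]]; rewrite size_map size_iota => /map_ext_iota gx Ah.
  have := triple _ _ _ (nA _ _ Ax Gg gx) Ax Ah.
  by rewrite -mulgA mulKg mulVKg.
move=> Ah; split; first exact: AG.
exists x; rewrite size_map size_iota /= mulVKg; split => //; exact: AG.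
Qed.

Lemma countable_branches n (G : closed_subset) : subgroup G ->
  countable (open_subgroups G) -> countable (branches (coset_tree n G)).
Proof.
move=> sG /(countable_open_cosets sG)/countable_injP[f f_inj].
apply/countable_injP; exists (fun z : nat -> bool => f (coset_of n [set k | z k] G)).
move=> y z; rewrite !inE => yT zT /f_inj e; apply: coset_of_inj (yT) (zT) _.
by apply: e; rewrite inE; exact: branch_open_coset.
Qed.

(** The third component of an index is a dummy that repeats each coset infinitely often, as needed
    for turning isomorphisms of groups into bijections of indices. *)
Lemma coset_enumeration (V : set effros) : measurable V ->
  (forall G : closed_subset, V G -> subgroup G) ->
  (forall G : closed_subset, V G -> countable (open_subgroups G)) ->
  exists (n : nat -> nat) (e : nat -> effros -> set nat),
    (forall j k, measurable_pred (fun G => e j G k)) /\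
    forall G : closed_subset, V G ->
      (forall j, open_coset G (coset_of (n j) (e j G) G)) /\
      (forall A, open_coset G A -> infinite_set [set j | coset_of (n j) (e j G) G = A]).
Proof.
move=> mV Vsub Vc.
have en n : exists e : nat -> effros -> set nat,
    [/\ forall j k, measurable [set G | e j G k],
      forall j G, e j G = set0 \/ branches (coset_tree n G) (fun k => `[< e j G k >]) &
      forall G z, V G -> branches (coset_tree n G) z -> exists j, e j G = [set k | z k]].
  apply: (@measurable_enumeration _ effros _ V (coset_tree n) valid_code decode mV).
  - exact: coset_tree_measurable.
  - exact: coset_tree_prefix.
  - exact: bianalytic_decode.
  - move=> G VG; have [|w wv wG] := @decode_surj G; last by exists w.
    by exists 1; have [] := Vsub G VG.
  - by move=> G VG; exact: countable_branches (Vsub G VG) (Vc G VG).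
have /choice[e eP] := en.
pose c j := odflt (0, 0, 0) (unpickle j : option (nat * nat * nat)).
exists (fun j => (c j).1.1), (fun j => e (c j).1.1 (c j).1.2); split.
  by move=> j k; have [+ _ _] := eP (c j).1.1; exact.
move=> G VG; have sG := Vsub G VG; split.
  move=> j; have [_ /(_ (c j).1.2 G)[->|eT] _] := eP (c j).1.1.
    by rewrite coset_of0; exact: open_coset0.
  have := branch_open_coset sG eT.
  suff -> : [set k | `[< e (c j).1.1 (c j).1.2 G k >]] = e (c j).1.1 (c j).1.2 G by [].
  by apply/seteqP; split=> k /asboolP.
move=> A /(open_coset_branch sG)[n [z [zT <-]]].
have [_ _ /(_ G z VG zT)[i ei]] := eP n.
apply: (@sub_infinite_set _ [set pickle (n, i, m) | m in [set: nat]]).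
  by move=> _ [m _ <-] /=; rewrite /c pickleK /= ei.
apply/infiniteP; have : ([set pickle (n, i, m) | m in [set: nat]] #= [set: nat])%card.
  by apply: inj_card_eq => m m' _ _ /(pcan_inj pickleK)[].
by rewrite card_eq_le => /andP[].
Qed.

(** * Reconstruction of a group from its open cosets *)

Definition mul_sub (C : nat -> set Sinf) a b c :=
  forall g h, C a g -> C b h -> C c (g * h).

Definition names_open_cosets (G : set Sinf) (C : nat -> set Sinf) :=
  (forall a, open_coset G (C a)) /\ (forall A, open_coset G A -> exists a, C a = A).

Section CosetClosure.
Variable (G : set Sinf) (sG : subgroup G).

Lemma open_cosetI A B : open_coset G A -> open_coset G B -> open_coset G (A `&` B).
Proof.
move=> [AG oA tA] [BG oB tB]; split=> [g [/AG]//|g [/oA[m mA] /oB[n nB]]|].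
  exists (maxn m n) => h Gh hg; split; [apply: mA|apply: nB] => // i ilt; apply: hg;
    by rewrite leq_max ilt ?orbT.
by move=> x y z [? ?] [? ?] [? ?]; split; [exact: tA|exact: tB].
Qed.

Lemma open_coset_mull g A : G g -> open_coset G A ->
  open_coset G [set x | A (g * x)].
Proof.
have [G1 GM GV] := sG.
move=> Gg [AG oA tA]; split=> [x /AG|x /oA[n nA]|x y z Ax Ay Az].
- by move/(GM _ _ (GV _ Gg)); rewrite mulKg.
- by exists n => h Gh hx; apply: nA; [exact: GM|exact: agree_mull].
- have := tA _ _ _ Ax Ay Az.
  by rewrite /= invgM !mulgA (mulgVK g).
Qed.

Lemma open_coset_mulr g A : G g -> open_coset G A ->
  open_coset G [set x | A (x * g)].
Proof.
have [G1 GM GV] := sG.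
move=> Gg [AG oA tA]; split=> [x /AG|x /oA[n nA]|x y z Ax Ay Az].
- by move/GM => /(_ _ (GV _ Gg)); rewrite mulgK.
- have [m mP] := map_agree (map g (iota 0 n)); exists m => h Gh /mP.
  rewrite -!map_mulg => /map_ext_iota hx; apply: nA => //; exact: GM.
- have := tA _ _ _ Ax Ay Az.
  by rewrite /= invgM !mulgA (mulgK g).
Qed.

Lemma open_coset_ball g n : G g -> open_coset G [set x | G x /\ agree n x g].
Proof.
have [G1 GM GV] := sG.
move=> Gg; split=> [x []//|x [Gx xg]|x y z [Gx xg] [Gy yg] [Gz zg]].
  by exists n => h Gh hx; split => // i ilt; rewrite hx ?xg.
split; first by apply: (GM) => //; apply: (GM) => //; exact: GV.
have yz : agree n (y^-1 * z : Sinf) (1 : Sinf).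
  by rewrite -(mulVg y); apply: agree_mull => i ilt; rewrite zg ?yg.
rewrite -mulgA => i ilt; rewrite (agree_mull x yz) // mulg1; exact: xg.
Qed.

End CosetClosure.

Section Preservation.
Variables (G : set Sinf) (C : nat -> set Sinf).
Hypotheses (sG : subgroup G) (CG : names_open_cosets G C).

(** The empty set, subgroups and inclusion are definable from the relation [mul_sub], hence they
    are preserved by every bijection that respects it. *)
Lemma mul_sub_empty a : C a = set0 <-> forall b c, mul_sub C a b c.
Proof.
split=> [a0 b c g h|H]; first by rewrite a0.
have [o o0] := CG.2 _ (open_coset0 G).
by apply/seteqP; split=> // g ag; have := H a o g g ag ag; rewrite o0.
Qed.

Lemma mul_sub_subgroup a : C a 1 <-> C a <> set0 /\ mul_sub C a a a.
Proof.
have [_ _ triple] := CG.1 a; split=> [a1|[/eqP/set0P[g ag] aa]].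
  split=> [a0|g h ag ah]; first by rewrite a0 in a1.
  by have := triple _ _ _ ag a1 ah; rewrite invg1 mulg1.
by have := triple _ _ _ ag (aa _ _ ag ag) ag; rewrite invgM mulgA mulgV mul1g mulVg.
Qed.

(** The subgroup witnessing the inclusion is the stabilizer of the larger coset. *)
Lemma mul_sub_incl a b : C a `<=` C b <->
  C a = set0 \/ exists u, C u 1 /\ mul_sub C a u b.
Proof.
split=> [ab|[->//|[u [u1 aub]] g ag]]; last by have := aub _ _ ag u1; rewrite mulg1.
have [->|/eqP/set0P[g ag]] := pselect (C a = set0); [by left|right].
have [bG _ triple] := CG.1 b.
have [u uE] := CG.2 _ (open_coset_mull sG (bG _ (ab _ ag)) (CG.1 b)).
exists u; rewrite /mul_sub uE /=; split; first by rewrite mulg1; exact: ab.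
by move=> x h /ab bx /(triple _ _ _ bx (ab _ ag)); rewrite mulgA mulgVK.
Qed.
End Preservation.

Section Reconstruction.
Variables (G H : closed_subset) (C D : nat -> set Sinf).
Hypotheses (sG : subgroup G) (sH : subgroup H).
Hypotheses (CG : names_open_cosets G C) (DH : names_open_cosets H D).
Variables (p q : nat -> nat).
Hypothesis qK : cancel q p.
Hypothesis pR : forall a b c, mul_sub C a b c <-> mul_sub D (p a) (p b) (p c).

Lemma image_empty a : C a = set0 <-> D (p a) = set0.
Proof.
rewrite (mul_sub_empty CG) (mul_sub_empty DH); split=> R b c; last exact/pR.
by rewrite -(qK b) -(qK c); apply/pR.
Qed.

Lemma image_subgroup a : C a 1 <-> D (p a) 1.
Proof.
rewrite (mul_sub_subgroup CG) (mul_sub_subgroup DH).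
by split=> -[a0 /pR aa]; split=> // /image_empty.
Qed.

Lemma image_incl a b : C a `<=` C b <-> D (p a) `<=` D (p b).
Proof.
rewrite (mul_sub_incl sG CG) (mul_sub_incl sH DH) image_empty.
split=> -[->|[u [u1 aub]]]; [by left| |by left|]; right.
  by exists (p u); split; [exact/image_subgroup|exact/pR].
by exists (q u); split; [apply/image_subgroup|apply/pR]; rewrite qK.
Qed.

(** Let [w] name the stabilizer of [0, ..., n-1] in [H] and [q w] the subgroup of [G] that
    corresponds to it.  The coset of [q w] through [g] corresponds to a coset [D (p a)], whose
    stabilizer, named [v], fixes [0, ..., n-1]: stabilizers are definable from [mul_sub], so [q v]
    lies in the stabilizer [q w] of [C a]. *)
Lemma image_small_coset g n : (G : set Sinf) g ->
  exists2 a, C a g & forall x y, D (p a) x -> D (p a) y -> agree n x y.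
Proof.
move=> Gg; have [H1 HM HV] := sH; have [G1 GM GV] := sG.
have [w wE] := DH.2 _ (open_coset_ball sH n H1).
have u1 : C (q w) 1 by apply/image_subgroup; rewrite qK wE; split.
have [a aE] := CG.2 _ (open_coset_mull sG (GV _ Gg) (CG.1 (q w))).
exists a => [|x y ax ay]; first by rewrite aE /= mulVg.
have [aH _ triple] := DH.1 (p a).
have [v vE] := DH.2 _ (open_coset_mull sH (aH _ ax) (DH.1 (p a))).
have av : mul_sub C a (q v) a.
  apply/pR; rewrite qK /mul_sub vE => s t /= as_ axt.
  by have := triple _ _ _ as_ ax axt; rewrite mulgA mulgVK.
have /image_incl : C (q v) `<=` C (q w).
  by move=> s vs; have := av g s; rewrite aE /= mulVg mulKg; exact.
rewrite !qK vE wE => /(_ (x^-1 * y)) /=; rewrite mulVKg => /(_ ay)[_ xy] i ilt.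
have := agree_mull x xy; rewrite mulVKg mulg1 => -> //.
Qed.

(** The cosets that contain [g] form a filter, which [p] carries to a filter on [H] containing sets
    that are constant on arbitrarily long initial segments.  The limit need not be surjective at
    this point. *)
Lemma image_limit g : (G : set Sinf) g -> exists f : nat -> nat,
  forall a n, C a g -> exists2 h, D (p a) h & agree n h f.
Proof.
move=> Gg.
have meet a b : C a g -> C b g -> exists2 h, D (p a) h & D (p b) h.
  move=> ag bg; have [c cE] := CG.2 _ (open_cosetI (CG.1 a) (CG.1 b)).
  have /eqP/set0P[h ch] : D (p c) <> set0.
    by move/image_empty; rewrite cE => ab; have : set0 g by rewrite -ab.
  exists h; [move: h ch; apply/image_incl|move: h ch; apply/image_incl];
    by rewrite cE => x [].
have /choice[a aP] n : exists a, C a g /\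
    forall x y, D (p a) x -> D (p a) y -> agree n x y.
  by have [a] := image_small_coset n Gg; exists a.
have /choice[h hP] n : exists h, D (p (a n)) h.
  by have [ag _] := aP n; have [h] := meet _ _ ag ag; exists h.
exists (fun i => h i.+1 i) => b n bg.
have [x bx ax] := meet _ _ bg (aP n).1; exists x => // i ilt.
rewrite ((aP n).2 _ _ ax (hP n) _ ilt).
have [y yn yi] := meet _ _ (aP n).1 (aP i.+1).1.
by rewrite -((aP n).2 _ _ yn (hP n) _ ilt) ((aP i.+1).2 _ _ yi (hP i.+1)).
Qed.

(** If [g * h] lies in an open coset [C c], then it lies in a product [C a * C b] of open cosets
    inside [C c] with [g] in [C a] and [h] in [C b].  Applying [p] shows that the limit functions
    compose, so the limits at [g] and [g^-1] are inverse permutations. *)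
Lemma reconstruct_morphism : exists phi : Sinf -> Sinf,
  [/\ forall g, (G : set Sinf) g -> (H : set Sinf) (phi g),
      forall g a, C a g -> D (p a) (phi g) &
      forall g h, (G : set Sinf) g -> (G : set Sinf) h -> phi (g * h) = phi g * phi h].
Proof.
have [G1 GM GV] := sG.
have /choice[f fP] g : exists f : nat -> nat, (G : set Sinf) g ->
    forall a n, C a g -> exists2 h, D (p a) h & agree n h f.
  have [/image_limit[f fP]|nG] := pselect ((G : set Sinf) g); first by exists f.
  by exists id.
have small g n : (G : set Sinf) g -> exists2 a, C a g &
    forall h, D (p a) h -> agree n h (f g).
  move=> Gg; have [a ag aP] := image_small_coset n Gg; exists a => // h ah i ilt.
  by have [x ax xf] := fP g Gg a n ag; rewrite (aP _ _ ah ax)// xf.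
have fM g h : (G : set Sinf) g -> (G : set Sinf) h -> forall i, f (g * h) i = f g (f h i).
  move=> Gg Gh i; have Ggh := GM _ _ Gg Gh.
  have [c cgh cP] := small _ i.+1 Ggh.
  have [_ _ triple] := CG.1 c.
  have [a aE] := CG.2 _ (open_coset_mulr sG Gh (CG.1 c)).
  have [b bE] := CG.2 _ (open_coset_mull sG Gg (CG.1 c)).
  have /pR abc : mul_sub C a b c.
    move=> x y; rewrite aE bE /= => xh gy.
    have := triple _ _ _ xh cgh gy.
    by rewrite invgM !mulgA mulgK mulgVK.
  have [y by_ yf] : exists2 y, D (p b) y & agree i.+1 y (f h).
    by apply: fP => //; rewrite bE.
  have [x ax xf] : exists2 x, D (p a) x & agree (y i).+1 x (f g).
    by apply: fP => //; rewrite aE.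
  rewrite -(cP _ (abc _ _ ax by_))// -yf// -xf//.
have f1 i : f 1 i = i.
  have [a a1 aP] := small 1 i.+1 G1; have /aP/(_ i) <- // : D (p a) 1 by apply/image_subgroup.
have fK g : (G : set Sinf) g -> cancel (f g) (f g^-1).
  by move=> Gg i; rewrite -fM ?mulVg//; exact: GV.
have fb g : exists s : Sinf, (G : set Sinf) g -> forall i, s i = f g i.
  have [Gg|nG] := pselect ((G : set Sinf) g); last by exists 1.
  have bf : bijective (f g).
    by exists (f g^-1); [exact: fK|have := fK _ (GV _ Gg); rewrite invgK].
  by exists (Sinf_of bf).
have /choice[phi phiE] := fb.
have phiH g : (G : set Sinf) g -> (H : set Sinf) (phi g).
  move=> Gg; apply: closed_subsetP => n; have [a ag _] := small g n Gg.
  have [h ah hf] := fP g Gg a n ag; exists h; first by have [aH _ _] := DH.1 (p a); exact: aH.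
  by move=> i ilt; rewrite phiE// hf.
exists phi; split => // [g a ag|g h Gg Gh].
  have Gg : (G : set Sinf) g by have [aG _ _] := CG.1 a; exact: aG.
  have [n nP] := open_coset_level sH (DH.1 (p a)).
  have [h ah hf] := fP g Gg a n ag; apply: nP ah (phiH _ Gg) _ => i ilt.
  by rewrite phiE// hf.
apply: Sinf_ext => i; rewrite phiE ?fM//; last exact: GM.
by rewrite -!phiE.
Qed.

End Reconstruction.

Lemma open_coset_separated (G : set Sinf) C g h : subgroup G ->
  names_open_cosets G C -> G g -> (forall a, C a g -> C a h) -> h = g.
Proof.
move=> sG CG Gg gh; apply: Sinf_ext => i.
have [a aE] := CG.2 _ (open_coset_ball sG i.+1 Gg).
by have : C a h; [by apply: gh; rewrite aE|rewrite aE => -[_]; apply].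
Qed.

Lemma within_continuous_Sinf (G : set Sinf) (phi : Sinf -> Sinf) :
  {within G, continuous phi} <-> forall g n, G g -> exists m, forall h, G h ->
    agree m h g -> agree n (phi h) (phi g).
Proof.
rewrite subspace_continuousP; split=> phiP g.
  move=> n Gg; have /(phiP g Gg) : nbhs (phi g) [set h : Sinf | agree n h (phi g)].
    by apply/nbhs_Sinf; exists n.
  by rewrite /= => /nbhs_Sinf[m mP]; exists m => h Gh /mP; exact.
move=> Gg A /nbhs_Sinf[n nA]; have [m mP] := phiP g n Gg.
by apply/nbhs_Sinf; exists m => h hg Gh; apply: nA; exact: mP.
Qed.

Lemma reconstruct_isomorphism (G H : closed_subset) (C D : nat -> set Sinf) p :
  subgroup G -> subgroup H -> names_open_cosets G C -> names_open_cosets H D ->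
  bijective p ->
  (forall a b c, mul_sub C a b c <-> mul_sub D (p a) (p b) (p c)) ->
  topologically_isomorphic G H.
Proof.
move=> sG sH CG DH [q pK qK] pR.
have qR a b c : mul_sub D a b c <-> mul_sub C (q a) (q b) (q c).
  by rewrite pR !qK.
have [phi [phiH phiD phiM]] := reconstruct_morphism sG sH CG DH qK pR.
have [psi [psiG psiC psiM]] := reconstruct_morphism sH sG DH CG pK qR.
have phiK g : (G : set Sinf) g -> psi (phi g) = g.
  move=> Gg; apply: (open_coset_separated sG CG Gg) => a /phiD/psiC.
  by rewrite pK.
have psiK h : (H : set Sinf) h -> phi (psi h) = h.
  move=> Hh; apply: (open_coset_separated sH DH Hh) => a /psiC/phiD.
  by rewrite qK.
exists phi, psi; split.
- by split.
- by split=> g; rewrite inE; [exact: phiK|exact: psiK].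
- by move=> g h; rewrite !inE; exact: phiM.
- apply/within_continuous_Sinf => g n Gg.
  have [b bE] := DH.2 _ (open_coset_ball sH n (phiH _ Gg)).
  have [m mP] : exists m, forall h, (G : set Sinf) h -> agree m h g -> C (q b) h.
    have [_ oq _] := CG.1 (q b); apply: oq; rewrite -(phiK _ Gg); apply: psiC.
    by rewrite bE; split=> //; exact: phiH.
  by exists m => h Gh /(mP _ Gh)/phiD; rewrite qK bE => -[].
- apply/within_continuous_Sinf => g n Gg.
  have [b bE] := CG.2 _ (open_coset_ball sG n (psiG _ Gg)).
  have [m mP] : exists m, forall h, (H : set Sinf) h -> agree m h g -> D (p b) h.
    have [_ oq _] := DH.1 (p b); apply: oq; rewrite -(psiK _ Gg); apply: phiD.
    by rewrite bE; split=> //; exact: psiG.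
  by exists m => h Gh /(mP _ Gh)/psiC; rewrite pK bE => -[].
Qed.

(** * Isomorphisms rename open cosets *)

(** All fibres are countably infinite, so corresponding ones can be matched. *)
Lemma matching_bijection T (Y : set T) (f g : nat -> T) :
  (forall i, Y (f i)) -> (forall i, Y (g i)) ->
  (forall y, Y y -> infinite_set [set i | f i = y]) ->
  (forall y, Y y -> infinite_set [set i | g i = y]) ->
  exists p : nat -> nat, bijective p /\ forall i, g (p i) = f i.
Proof.
move=> fY gY f_inf g_inf.
have /choice[b bP] y : exists b : nat -> nat,
    Y y -> set_bij [set i | f i = y] [set i | g i = y] b.
  have [Yy|nY] := pselect (Y y); last by exists id.
  have : ([set i | f i = y] #= [set i | g i = y])%card.
    apply: card_eq_trans (eq_card_nat (countableP _) (f_inf _ Yy)) _.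
    by rewrite card_eq_sym; exact: eq_card_nat (countableP _) (g_inf _ Yy).
  by move=> /card_set_bijP[b bb]; exists b.
exists (fun i => b (f i) i).
have gb i : g (b (f i) i) = f i by have [/(_ i erefl)] := bP _ (fY i).
split=> //; rewrite -setTT_bijective; split=> // [i j _ _ bij|j _].
  have fij : f i = f j by rewrite -(gb i) bij gb.
  have [_ inj _] := bP _ (fY j); apply: inj; rewrite ?inE//=.
  by rewrite -bij fij.
have [_ _ /(_ j erefl)[i /= fi bi]] := bP _ (gY j).
by exists i => //; rewrite fi.
Qed.

Section IsomorphismTransport.
Variables (G H : set Sinf) (sG : subgroup G) (sH : subgroup H).
Variables (phi psi : Sinf -> Sinf).
Hypotheses (phiH : set_fun G H phi) (psiG : set_fun H G psi).
Hypotheses (phiK : {in G, cancel phi psi}) (psiK : {in H, cancel psi phi}).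
Hypothesis phiM : {in G &, {morph phi : x y / x * y}}.
Hypotheses (phic : {within G, continuous phi}) (psic : {within H, continuous psi}).

Lemma image_open_coset A : open_coset G A -> open_coset H (phi @` A).
Proof.
have [G1 GM GV] := sG; have [H1 HM HV] := sH.
move=> [AG oA tA]; split=> [_ [x /AG/phiH Hx <-]//|_ [x Ax <-]|_ _ _ [x Ax <-] [y Ay <-] [z Az <-]].
  have [n nA] := oA x Ax; have Gx := AG _ Ax.
  have [m mP] := (within_continuous_Sinf _ _).1 psic _ n (phiH Gx).
  exists m => h Hh hx; exists (psi h); last by rewrite psiK// inE.
  by apply: nA; [exact: psiG|have := mP _ Hh hx; rewrite phiK// inE].
exists (x * y^-1 * z); first exact: tA.
have [Gx Gy Gz] : [/\ G x, G y & G z] by split; exact: AG.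
have phiV : phi y^-1 = (phi y)^-1.
  apply: (mulIg (phi y)); rewrite mulVg -phiM ?inE ?mulVg//; last exact: GV.
  by apply: (mulgI (phi 1)); rewrite mulg1 -phiM ?inE// mulg1.
by rewrite !phiM ?inE ?phiV//; [exact: GV|apply: GM => //; exact: GV].
Qed.
End IsomorphismTransport.

Lemma open_coset_preimage (G H : set Sinf) phi psi : 
  subgroup G -> subgroup H ->
  set_fun G H phi -> set_fun H G psi ->
  {in G, cancel phi psi} -> {in H, cancel psi phi} ->
  {in G &, {morph phi : x y / x * y}} ->
  {within G, continuous phi} -> {within H, continuous psi} ->
  forall B, open_coset H B -> exists2 A, open_coset G A & phi @` A = B.
Proof.
move=> sG sH phiH psiG phiK psiK phiM phic psic B cB; have [BH _ _] := cB.
exists (psi @` B).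
  apply: (@image_open_coset H G sH sG psi phi) => // x y; rewrite !inE => Hx Hy.
  have [_ HM _] := sH; have [_ GM _] := sG.
  rewrite -[x in LHS]psiK ?inE// -[y in LHS]psiK ?inE// -phiM ?inE; try exact: psiG.
  by rewrite phiK// inE; apply: GM; exact: psiG.
apply/seteqP; split=> [_ [_ [h Bh <-] <-]|h Bh]; first by rewrite psiK// inE; exact: BH.
by exists (psi h); [exists h|rewrite psiK// inE; exact: BH].
Qed.

Lemma isomorphism_renaming (G H : set Sinf) (C D : nat -> set Sinf) :
  subgroup G -> subgroup H ->
  (forall j, open_coset G (C j)) -> (forall j, open_coset H (D j)) ->
  (forall A, open_coset G A -> infinite_set [set j | C j = A]) ->
  (forall A, open_coset H A -> infinite_set [set j | D j = A]) ->
  topologically_isomorphic G H ->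
  exists2 p, bijective p &
    (forall a b c, mul_sub C a b c <-> mul_sub D (p a) (p b) (p c)).
Proof.
move=> sG sH cC cD iC iD [phi [psi [[phiH psiG] [phiK psiK] phiM phic psic]]].
have [_ GM _] := sG.
have phi_inj A B : A `<=` G -> B `<=` G -> phi @` A `<=` phi @` B -> A `<=` B.
  move=> AG BG AB x Ax; have [|y By xy] := AB (phi x); first by exists x.
  by rewrite -(phiK x) ?inE; [rewrite -xy phiK// inE; exact: BG|exact: AG].
have CG j : C j `<=` G by have [] := cC j.
have iphi B : open_coset H B -> infinite_set [set j | phi @` C j = B].
  move=> /(open_coset_preimage sG sH phiH psiG phiK psiK phiM phic psic)[A cA <-].
  by apply: sub_infinite_set (iC A cA) => j /= ->.
have cphi j : open_coset H (phi @` C j) by exact: (image_open_coset sG sH phiH psiG).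
have [p [p_bij pE]] := matching_bijection cphi cD iphi iD.
exists p => // a b c; split=> abc.
  move=> g h; rewrite !pE => -[x ax <-] [y by_ <-].
  exists (x * y); first exact: abc.
  by rewrite phiM// inE; [exact: CG ax|exact: CG by_].
move=> x y ax by_; have := abc (phi x) (phi y); rewrite !pE.
case; [by exists x|by exists y|move=> z cz].
rewrite -phiM ?inE//; [|exact: CG ax|exact: CG by_] => zxy.
have <- : z = x * y; last by [].
rewrite -[LHS]phiK ?inE; last exact: CG cz.
by rewrite zxy phiK// inE; apply: GM; [exact: CG ax|exact: CG by_].
Qed.

(** * Borel maps into the space of structures *)

Section StructureMeasurability.
Context d (X : measurableType d) (L : language).
Variable M : X -> structure_space L.
Hypothesis mrel : forall R (a : (rel_arity R).-tuple nat), measurable_pred (fun x => (M x).1 R a).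
Hypothesis mfun : forall f (a : (fun_arity f).-tuple nat) k,
  measurable_pred (fun x => (M x).2 f a = k).

Let atom : countType :=
  ({R : rel_symbol L & (rel_arity R).-tuple nat} +
   {f : fun_symbol L & (fun_arity f).-tuple nat})%type.

Let value (x : X) (i : atom) : nat := match i with
  | inl (existT R a) => (M x).1 R a
  | inr (existT f a) => (M x).2 f a end.

Lemma value_measurable i k : measurable_pred (fun x => value x i = k).
Proof.
case: i => [[R a]|[f a]] /=; last exact: mfun.
case: k => [|[|k]].
- apply: mpred_ext (mpred_not (mrel a)) => x.
  by case: ((M x).1 R a); split=> // /(_ isT).
- by apply: mpred_ext (mrel a) => x; case: ((M x).1 R a); split.
- by apply: mpred_ext (mpred_cst X False) => x; case: ((M x).1 R a); split.
Qed.

(** Finitely many values of relations and functions of [M x] force it into [U]: the product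
    topology is generated by these values, which are discrete. *)
Lemma structure_open_values (U : set (structure_space L)) x : open U -> U (M x) ->
  exists n, forall y, (forall i, pickle i < n -> value y i = value x i) -> U (M y).
Proof.
move=> oU UMx.
pose F : set_system X := [set A | exists n, forall y,
  (forall i, pickle i < n -> value y i = value x i) -> A y].
have FF : Filter F.
  split; first by exists 0.
    move=> P Q [m mP] [n nQ]; exists (maxn m n) => y yx.
    by split; [apply: mP|apply: nQ] => i ilt; apply: yx; rewrite leq_max ilt ?orbT.
  by move=> P Q PQ [m mP]; exists m => y /mP/PQ.
have M1 : (fun y => (M y).1) @ F --> (M x).1.
  apply: prod_topology_cvg => R; apply: prod_topology_cvg => a A /nbhs_singleton Ax.
  exists (pickle (inl (existT _ R a) : atom)).+1 => y.
  move=> /(_ (inl (existT _ R a)) (leqnn _)) /= yx.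
  suff -> : (M y).1 R a = (M x).1 R a by [].
  by case: ((M y).1 R a) ((M x).1 R a) yx => -[].
have M2 : (fun y => (M y).2) @ F --> (M x).2.
  apply: prod_topology_cvg => f; apply: prod_topology_cvg => a A /nbhs_singleton Ax.
  exists (pickle (inr (existT _ f a) : atom)).+1 => y.
  by move=> /(_ (inr (existT _ f a)) (leqnn _)) /= ->.
have UMx' : nbhs (M x) U by exact: open_nbhs_nbhs.
have [n nU] : F [set y | U ((M y).1, (M y).2)] by exact: (cvg_pair M1 M2 UMx').
by exists n => y /nU /=; rewrite -surjective_pairing.
Qed.

(** By [structure_open_values] the preimage of an open set is a union of sets given by finite lists
    of values, of which there are countably many. *)
Lemma measurable_structure (V : set X) : measurable V ->
  measurable_fun V (M : X -> borel_structure L).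
Proof.
move=> mV.
apply: (@measurability _ _ X (borel_structure L) V M
  [set U : set (structure_space L) | open U]) => //.
move=> _ [U /= oU <-]; apply: measurableI => //.
have : measurable_pred (fun x => exists s : seq nat,
    (forall y, (forall i, pickle i < size s -> value y i = nth 0 s (pickle i)) -> U (M y)) /\
    forall i, pickle i < size s -> value x i = nth 0 s (pickle i)).
  apply: mpred_exists => s; apply: mpred_and; first exact: mpred_cst.
  apply: mpred_forall => i; apply: mpred_imply; first exact: mpred_cst.
  exact: value_measurable.
apply: mpred_ext => x; split=> [[s [sU sx]]|/(structure_open_values oU)[n nU]]; first exact: sU.
pose v k := if unpickle k is Some i then value x i else 0.
have vE i : pickle i < n -> nth 0 (mkseq v n) (pickle i) = value x i.
  by move=> ilt; rewrite nth_mkseq// /v pickleK.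
exists (mkseq v n); rewrite size_mkseq; split=> [y yv|i ilt]; last by rewrite vE.
by apply: nU => i ilt; rewrite yv// vE.
Qed.
End StructureMeasurability.

Definition ternary_language : language :=
  @Language unit (fun=> 3) void (fun=> 0).

Definition ternary_structure (P : nat -> nat -> nat -> Prop) :
    structure_space ternary_language :=
  (fun=> fun a : 3.-tuple nat =>
     `[< P (tnth a ord0) (tnth a (inord 1)) (tnth a (inord 2)) >],
   fun f : void => match f with end).

Lemma ternary_structure_isomorphic P Q :
  structure_isomorphic (ternary_structure P) (ternary_structure Q) <->
  exists2 p, bijective p & forall a b c, P a b c <-> Q (p a) (p b) (p c).
Proof.
split=> [[p [p_bij pR _]]|[p p_bij pR]].
  exists p => // a b c; have := pR tt [tuple a; b; c].
  rewrite /= !tnth_map !(tnth_nth 0) /= !inordK//= => PQ.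
  by split=> /asboolP; [rewrite -PQ|rewrite PQ] => /asboolP.
exists p; split=> // -[] a; rewrite /= !tnth_map.
by apply: asbool_equiv_eq; apply: iff_sym; exact: pR.
Qed.

(** Whether [g * h] lies in a coset depends only on finitely many values of [g] and [h]: if [h] maps
    the initial segment of length [n c] to [t], then [g * h] maps it to the image of [t] under [g].
    So the relation quantifies over finite sequences and hits. *)
Lemma mul_sub_measurable (n : nat -> nat) (e : nat -> effros -> set nat) :
  (forall j k, measurable_pred (fun G => e j G k)) ->
  exists R : effros -> nat -> nat -> nat -> Prop,
    (forall a b c, measurable_pred (fun G => R G a b c)) /\
    forall G : closed_subset, subgroup G -> forall a b c,
      R G a b c <-> mul_sub (fun j => coset_of (n j) (e j G) G) a b c.
Proof.
move=> me.
exists (fun G a b c => forall s t t' u,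
  hits (pointwise (iota 0 (n b)) s `&` pointwise (iota 0 (n c)) t) G ->
  hits (pointwise (iota 0 (n a)) t' `&` pointwise t u) G ->
  e a G (pickle t') -> e b G (pickle s) -> e c G (pickle u)); split.
  move=> a b c; do 4!apply: mpred_forall => ?.
  by do 2!(apply: mpred_imply; first exact: hits2_measurable);
    do 2!(apply: mpred_imply; first exact: me).
move=> G [G1 GM GV] a b c; split.
  move=> R g h [Gg ag] [Gh bh]; split; first exact: GM.
  apply: R ag bh; [exists h|exists g]; split => //; split => //.
  by rewrite /pointwise /= map_mulg.
move=> R s t t' u [h [Gh [hs ht]]] [g [Gg [gt gu]]] ea eb.
have [||_] := R g h; [by split => //=; rewrite gt|by split => //=; rewrite hs|].
by rewrite map_mulg ht gu.
Qed.

(** The invariant of [G] is its coarse group, with names in place of cosets. *)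
Theorem isomorphism_classifiable (V : set effros) :
  measurable V ->
  (forall G : closed_subset, V G -> subgroup G) ->
  (forall G : closed_subset, V G -> countable (open_subgroups G)) ->
  classifiable_by_countable_structures V
    (fun G H : closed_subset => topologically_isomorphic G H).
Proof.
move=> mV Vsub Vc; split => //.
have [n [e [me eP]]] := coset_enumeration mV Vsub Vc.
have [R [mR RP]] := mul_sub_measurable n me.
exists ternary_language, (fun G => ternary_structure (R G)); split.
  apply: measurable_structure => // r a.
  apply: mpred_ext (mR (tnth a ord0) (tnth a (inord 1)) (tnth a (inord 2))) => G.
  by split=> /asboolP.
move=> G H VG VH; rewrite ternary_structure_isomorphic.
have sG := Vsub _ VG; have sH := Vsub _ VH.
have [cG iG] := eP _ VG; have [cH iH] := eP _ VH.
have names K : V K -> names_open_cosets (K : closed_subset)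
    (fun j => coset_of (n j) (e j K) (K : closed_subset)).
  move=> VK; have [cK iK] := eP _ VK; split => // A /iK/infinite_setN0[j <-].
  by exists j.
split.
  move=> /(isomorphism_renaming sG sH cG cH iG iH)[p p_bij pR].
  by exists p => // a b c; rewrite (RP G)// (RP H).
move=> [p p_bij pR].
apply: (reconstruct_isomorphism sG sH (names _ VG) (names _ VH) p_bij) => a b c.
by rewrite -(RP G)// -(RP H).
Qed.

(** * Oligomorphic and Roelcke precompact groups *)

Lemma map_iota_id (u : Sinf) n :
  map u (iota 0 n) = iota 0 n <-> agree n u (1 : Sinf).
Proof. by rewrite -[X in _ = X]map_id; exact: map_ext_iota. Qed.

(** As [G] is closed, closure under the group operations can be tested on finite
    approximations. *)
Lemma subgroup_hits (G : closed_subset) : subgroup G <->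
  (forall n, hits (pointwise (iota 0 n) (iota 0 n)) G) /\
  (forall n s t, hits (pointwise (iota 0 n) s) G -> hits (pointwise s t) G ->
    hits (pointwise (iota 0 n) t) G) /\
  (forall n s, hits (pointwise s (iota 0 n)) G -> hits (pointwise (iota 0 n) s) G).
Proof.
split=> [[G1 GM GV]|[h1 [hM hV]]].
  split=> [n|]; [|split=> [n s t [h [Gh hs]] [g [Gg gt]]|n s [g [Gg gs]]]].
  - by exists 1; split=> //; rewrite /pointwise /= map_id.
  - by exists (g * h); split; [exact: GM|rewrite /pointwise /= map_mulg hs].
  - by exists g^-1; split; [exact: GV|rewrite /pointwise /= -gs map_mulKg].
split=> [|x y Gx Gy|x Gx]; apply: closed_subsetP => n.
- by have [h [Gh hn]] := h1 n; exists h => //; exact/map_iota_id.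
- have [||h [Gh hn]] := hM n (map y (iota 0 n)) (map x (map y (iota 0 n))).
  + by exists y.
  + by exists x.
  by exists h => //; apply/map_ext_iota; rewrite hn map_mulg.
- have [|h [Gh hn]] := hV n (map ((x^-1)%g : Sinf) (iota 0 n)).
    by exists x; split => //; rewrite /pointwise /= -map_mulg mulgV map_id.
  by exists h => //; exact/map_ext_iota.
Qed.

Lemma subgroup_measurable : measurable_pred (fun G : effros => subgroup (G : closed_subset)).
Proof.
apply: (@mpred_ext _ effros _ _ (fun G => iff_sym (subgroup_hits G))).
apply: mpred_and; first by apply: mpred_forall => n; exact: hits1_measurable.
apply: mpred_and.
  do 3!apply: mpred_forall => ?.
  by do 2!(apply: mpred_imply; first exact: hits1_measurable); exact: hits1_measurable.
by do 2!apply: mpred_forall => ?; apply: mpred_imply; exact: hits1_measurable.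
Qed.

(** There are finitely many double cosets of the stabilizer of [0, ..., n-1]: they correspond to
    the orbits of the stabilizer on the images of [iota 0 n], and [bs] meets all these orbits. *)
Definition finite_double_cosets (G : closed_subset) := forall n,
  exists bs : seq (seq nat), forall s, hits (pointwise (iota 0 n) s) G ->
    exists b, b \in bs /\
      hits (pointwise (iota 0 n) (iota 0 n) `&` pointwise b s) G.

Lemma finite_double_cosets_measurable : measurable_pred (finite_double_cosets : effros -> Prop).
Proof.
apply: mpred_forall => n; apply: mpred_exists => bs; apply: mpred_forall => s.
apply: mpred_imply; first exact: hits1_measurable.
apply: mpred_exists => b; apply: mpred_and; first exact: mpred_cst.
exact: hits2_measurable.
Qed.

Lemma roelcke_precompact_double_cosets (G : closed_subset) : subgroup G ->
  roelcke_precompact G <-> finite_double_cosets G.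
Proof.
move=> [G1 GM GV]; split=> [rG n|fG U UG].
  pose U : set Sinf := [set g | (G : set Sinf) g /\ agree n g (1 : Sinf)].
  have [||F [finF FG UFU]] := rG U; first by move=> g [].
    by apply/nbhs_Sinf; exists n.
  have /finite_seqP[bs bsE] := finite_image (fun f : Sinf => map f (iota 0 n)) finF.
  exists bs => s [g [Gg gs]].
  have [u [f [v [[Gu u1] Ff [Gv v1] guv]]]] : [set x | exists u f v,
    [/\ U u, F f, U v & x = u * f * v]] g by rewrite UFU.
  exists (map f (iota 0 n)); split.
    by have : [set` bs] (map f (iota 0 n)) by rewrite -bsE; exists f.
  exists u; split=> //; split; first exact/map_iota_id.
  by rewrite /pointwise /= -gs guv !map_mulg (map_iota_id v n).2.
move=> /nbhs_Sinf[n nU]; have [bs bsP] := fG n.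
have /choice[f fP] b : exists f : Sinf, (G : set Sinf) f /\
    (hits (pointwise (iota 0 n) b) G -> map f (iota 0 n) = b).
  have [[f [Gf fb]]|nb] := pselect (hits (pointwise (iota 0 n) b) G); first by exists f.
  by exists 1; split.
exists [set f b | b in [set` bs]]; split.
- exact/finite_image/finite_seq.
- by move=> _ [b _ <-]; have [] := fP b.
apply/seteqP; split=> [x [u [_ [v [Uu [b _ <-] Uv ->]]]]|x Gx] /=.
  by apply: (GM); [apply: GM; [exact: UG|have [] := fP b]|exact: UG].
have [|b [bbs [u [Gu [u1 ub]]]]] := bsP (map (x : Sinf) (iota 0 n)); first by exists x.
have [Gf fb] := fP b.
have {}fb : map (f b) (iota 0 n) = b.
  apply: fb; exists (u^-1 * x); split; first by apply: GM => //; exact: GV.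
  by rewrite /pointwise /= map_mulg -ub map_mulKg.
exists u, (f b), ((f b)^-1 * (u^-1 * x)); split.
- by apply: nU Gu; exact/map_iota_id.
- by exists b.
- apply: nU; last by apply: (GM); [exact: GV|apply: GM => //; exact: GV].
  apply/map_iota_id; rewrite !map_mulg -ub map_mulKg.
  by rewrite -[X in map _ X = _]fb map_mulKg.
- by rewrite -[RHS]mulgA mulVKg mulVKg.
Qed.

Lemma oligomorphic_orbits (G : closed_subset) : subgroup G ->
  oligomorphic G <-> forall n, exists bs : seq (seq nat), forall t : n.-tuple nat,
    exists b, b \in bs /\ hits (pointwise b t) G.
Proof.
move=> [G1 GM GV]; split=> oG n; last first.
  have [bs bsP] := oG n.
  pose F (b : seq nat) : set (n.-tuple nat) := [set t |
    exists2 g : Sinf, (G : set Sinf) g & map g b = t].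
  apply: sub_finite_set (finite_image F (finite_seq bs)) => _ [t _ <-].
  have [b [bbs [g [Gg gb]]]] := bsP t; exists b => //.
  apply/seteqP; split=> s /=.
    move=> [h Gh hb]; exists (h * g^-1); first by apply: GM => //; exact: GV.
    by apply: val_inj; rewrite /= -gb map_mulg map_mulKg.
  move=> [h Gh <-]; exists (h * g); first exact: GM.
  by rewrite map_mulg gb.
have /choice[r rP] (o : set (n.-tuple nat)) : exists t, forall s,
    tuple_orbit G s = o -> tuple_orbit G t = o.
  have [[t tP]|no] := pselect (exists t, tuple_orbit G t = o); first by exists t.
  by exists [tuple of nseq n 0] => s so; case: no; exists s.
have /finite_seqP[bs bsE] := finite_image r (oG n).
exists (map val bs) => t; exists (val (r (tuple_orbit G t))); split.
  apply: map_f; have : [set` bs] (r (tuple_orbit G t)).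
    by rewrite -bsE; exists (tuple_orbit G t) => //; exists t.
  by [].
have : tuple_orbit G (r (tuple_orbit G t)) t.
  rewrite (rP _ t erefl); exists 1 => //; apply: val_inj; exact: map_id.
by move=> [g Gg gt]; exists g; split => //; rewrite /pointwise /= -[in RHS]gt.
Qed.

(** The double coset of [g] is determined by the orbit of the concatenation of [iota 0 n] and its
    image under [g], an orbit on tuples of length [n + n]. *)
Lemma oligomorphic_double_cosets (G : closed_subset) : subgroup G ->
  oligomorphic G -> finite_double_cosets G.
Proof.
move=> sG oG n; have [G1 GM GV] := sG.
pose i := iota_tuple n 0.
pose t (g : Sinf) : (n + n).-tuple nat := cat_tuple i (map_tuple g i).
have /choice[r rP] (o : set ((n + n).-tuple nat)) : exists b : seq nat,
    forall x : Sinf, (G : set Sinf) x -> tuple_orbit G (t x) = o ->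
    exists g : Sinf, [/\ (G : set Sinf) g, tuple_orbit G (t g) = o & b = map g (iota 0 n)].
  have [[g [Gg go]]|no] := pselect (exists g, (G : set Sinf) g /\ tuple_orbit G (t g) = o).
    by exists (map g (iota 0 n)) => x Gx xo; exists g.
  by exists [::] => x Gx xo; case: no; exists x.
have /finite_seqP[bs bsE] := finite_image r (oG (n + n)).
exists bs => s [x [Gx <-]].
have [g [Gg go bg]] := rP _ x Gx erefl.
exists (r (tuple_orbit G (t x))); split.
  have : [set` bs] (r (tuple_orbit G (t x))).
    by rewrite -bsE; exists (tuple_orbit G (t x)) => //; exists (t x).
  by [].
have : tuple_orbit G (t g) (t x).
  rewrite go; exists 1 => //; apply: val_inj; exact: map_id.
move=> [u Gu /(congr1 val)/= /eqP]; rewrite map_cat eqseq_cat ?size_map//.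
by move=> /andP[/eqP u1 /eqP ug]; exists u; split => //; split => //; rewrite bg.
Qed.

(** An open subgroup containing the stabilizer of [0, ..., n-1] is a union of its double cosets,
    so it is determined by [n] and a sublist of the finite list of representatives. *)
Lemma countable_open_subgroups (G : closed_subset) : subgroup G ->
  finite_double_cosets G -> countable (open_subgroups G).
Proof.
move=> [G1 GM GV] fG.
pose F (ns : nat * seq (seq nat)) : set Sinf := [set g | (G : set Sinf) g /\
  exists b, b \in ns.2 /\
    hits (pointwise (iota 0 ns.1) (iota 0 ns.1) `&` pointwise b (map g (iota 0 ns.1))) G].
apply: (@sub_countable _ _ _ (F @` setT)); last first.
  by apply: sub_countable (card_image_le _ _) _; exact: countableP.
apply: subset_card_le => U [[U1 UM UV] UG [O oO UE]].
have [n nU] : exists n, forall g, (G : set Sinf) g -> map g (iota 0 n) = iota 0 n -> U g.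
  have [|n nO] := (open_Sinf O).1 oO 1; first by move: U1; rewrite UE => -[].
  by exists n => g Gg gn; rewrite UE; split => //; apply: nO; exact/map_iota_id.
have [bs bsP] := fG n.
pose P b := `[< exists2 u : Sinf, U u & map u (iota 0 n) = b >].
exists (n, [seq b <- bs | P b]) => //.
apply/seteqP; split=> g.
  move=> [Gg [b]]; rewrite /= mem_filter => -[/andP[/asboolP[u Uu ub] _] [w [Gw [w1 wb]]]].
  have Uw : U w by exact: nU.
  have Uv : U ((w * u)^-1 * g).
    apply: nU; first by apply: (GM) => //; apply: GV; apply: GM => //; exact: UG.
    by rewrite map_mulg -wb -ub -(map_mulg w u) map_mulKg.
  by rewrite -[g](mulVKg (w * u)); apply: (UM) => //; exact: UM.
move=> Ug; have Gg := UG _ Ug; split => //=.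
have [|b [bbs [w [Gw [w1 wb]]]]] := bsP (map g (iota 0 n)); first by exists g.
have Uw : U w by exact: nU.
exists b; rewrite mem_filter bbs andbT; split; last by exists w.
apply/asboolP; exists (w^-1 * g); first by apply: UM => //; exact: UV.
by rewrite map_mulg -wb map_mulKg.
Qed.

Theorem corollary3p4 :
  (forall V : set effros,
     measurable V ->
     (forall G : closed_subset, V G -> subgroup G) ->
     conjugation_closed V ->
     (forall G : closed_subset, V G -> countable (open_subgroups G)) ->
     classifiable_by_countable_structures V
       (fun G H : closed_subset => topologically_isomorphic G H))
  /\ classifiable_by_countable_structures
       (oligomorphic_subgroups : set effros)
       (fun G H : closed_subset => topologically_isomorphic G H)
  /\ classifiable_by_countable_structures
       (roelcke_precompact_subgroups : set effros)
       (fun G H : closed_subset => topologically_isomorphic G H).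
Proof.
split=> [V mV sV _ cV|]; first exact: isomorphism_classifiable.
split; apply: isomorphism_classifiable.
- have mO : measurable_pred (fun G : effros => forall n, exists bs : seq (seq nat),
      forall t : n.-tuple nat, exists b, b \in bs /\ hits (pointwise b t) G).
    apply: mpred_forall => n; apply: mpred_exists => bs; apply: mpred_forall => t.
    apply: mpred_exists => b; apply: mpred_and; first exact: mpred_cst.
    exact: hits1_measurable.
  apply: mpred_ext (mpred_and subgroup_measurable mO) => G.
  by split=> -[sG oG]; split=> //; exact/(oligomorphic_orbits sG).
- by move=> G [].
- by move=> G [sG /(oligomorphic_double_cosets sG)]; exact: countable_open_subgroups.
- apply: mpred_ext (mpred_and subgroup_measurable finite_double_cosets_measurable) => G.
  by split=> -[sG rG]; split=> //; exact/(roelcke_precompact_double_cosets sG).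
- by move=> G [].
- move=> G [sG /(roelcke_precompact_double_cosets sG)].
  exact: countable_open_subgroups.
Qed.
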